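(* Let $a,m\ge0$, $\ell\ge1$ and $0\le p\le\ell$ be integers, and let $\mathcal{C}^p_\ell(m,a)$ be the arrangement in $\mathbb{R}^\ell$ consisting of the hyperplanes $x_i+x_j=s$ and $x_i-x_j=s$ for $1\le i<j\le\ell$ and integers $-a\le s\le a$; $2x_i=s$ for $1\le i\le p$ and integers $1-m\le s\le m$; and $2x_i=s$ for $p<i\le\ell$ and integers $-m\le s\le m$. Then the cone $\mathbf{c}\mathcal{C}^p_\ell(m,a)$ is free with exponents $$\big(1,\ c+2\ell-p-1,\ c+1,\ c+3,\ c+5,\dots,\ c+2\ell-3\big),\qquad c=2m+2a\ell-2a.$$
   Context: For an affine arrangement $\mathcal{A}$ in $\mathbb{R}^\ell$, its cone $\mathbf{c}\mathcal{A}$ is the central arrangement in $\mathbb{R}^{\ell+1}$ (extra coordinate $z$) consisting of the hyperplanes $a_1x_1+\dots+a_\ell x_\ell=dz$ for each hyperplane $a_1x_1+\dots+a_\ell x_\ell=d$ of $\mathcal{A}$, together with $z=0$. A central arrangement $\mathcal{A}$ in $\mathbb{R}^n$ is free if $D(\mathcal{A})=\{\theta\in\mathrm{Der}(S):\theta(\alpha_H)\in\alpha_HS\text{ for all }H=\ker\alpha_H\in\mathcal{A}\}$ is a free module over $S=\mathbb{R}[x_1,\dots,x_n]$; the exponents are the degrees of a homogeneous basis. *)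

(* Defs.v *)
From HB Require Import structures.
From mathcomp Require Import all_boot all_order all_algebra.
From mathcomp Require Export reals mpoly.

Set Implicit Arguments.
Unset Strict Implicit.
Unset Printing Implicit Defensive.
Import GRing.Theory Num.Theory.
Local Open Scope ring_scope.

Section Derivations.
Variables (R : realType) (n : nat).

(* The R-linear derivations of S = R[x_1, ..., x_n]. *)
Record der := Der {
  der_fun :> {linear {mpoly R[n]} -> {mpoly R[n]}};
  der_leibniz : forall f g : {mpoly R[n]},
    der_fun (f * g) = der_fun f * g + f * der_fun g }.

Definition linear_form (v : 'rV[R]_n) : {mpoly R[n]} :=
  \sum_(i < n) v 0 i *: 'X_i.

(* A central arrangement is given by the normal vectors of its hyperplanes;
   whether a derivation is logarithmic does not depend on the scaling of the
   normals or on repetitions. *)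
Definition central_arrangement := 'rV[R]_n -> Prop.

(* theta \in D(A) *)
Definition logarithmic (A : central_arrangement) (theta : der) : Prop :=
  forall v, A v -> exists g, theta (linear_form v) = linear_form v * g.

(* theta_0, ..., theta_(k-1) is a basis of the S-module D(A) *)
Definition log_basis (A : central_arrangement) (k : nat)
    (theta : 'I_k -> der) : Prop :=
  [/\ forall i, logarithmic A (theta i),
      forall delta : der, logarithmic A delta ->
        exists f : 'I_k -> {mpoly R[n]},
          forall g, delta g = \sum_(i < k) f i * theta i g
    & forall f : 'I_k -> {mpoly R[n]},
        (forall g, \sum_(i < k) f i * theta i g = 0) -> forall i, f i = 0].

(* Polynomial degree: theta = \sum_i f_i d/dx_i with every f_i = theta x_i
   homogeneous of degree d. *)
Definition homogeneous_der (d : nat) (theta : der) : Prop :=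
  forall i : 'I_n, theta 'X_i \is d.-homog.

Definition free_arrangement (A : central_arrangement) : Prop :=
  exists (k : nat) (theta : 'I_k -> der), log_basis A theta.

Definition has_exponents (A : central_arrangement) (e : seq nat) : Prop :=
  exists theta : 'I_(size e) -> der,
    log_basis A theta /\
    forall i : 'I_(size e), homogeneous_der (nth 0%N e i) (theta i).

End Derivations.

(* The pair (v, d) stands for the hyperplane v_1 x_1 + ... + v_l x_l = d. *)
Definition affine_arrangement (R : realType) (l : nat) :=
  'rV[R]_l -> R -> Prop.

(* The additional coordinate z comes last. *)
Inductive cone (R : realType) (l : nat) (A : affine_arrangement R l) :
    central_arrangement R (l + 1) :=
| cone_affine v d : A v d -> cone A (row_mx v (const_mx (- d)))
| cone_infinity : cone A (row_mx 0 (const_mx 1)).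

(* Coordinates are numbered from 0, so that 1 <= i <= p becomes i < p. *)
Inductive arrC (R : realType) (l p m a : nat) : affine_arrangement R l :=
| arrC_add (i j : 'I_l) (s : int) :
    (i < j)%N -> - a%:Z <= s <= a%:Z ->
    arrC p m a (delta_mx 0 i + delta_mx 0 j) s%:~R
| arrC_sub (i j : 'I_l) (s : int) :
    (i < j)%N -> - a%:Z <= s <= a%:Z ->
    arrC p m a (delta_mx 0 i - delta_mx 0 j) s%:~R
| arrC_low (i : 'I_l) (s : int) :
    (i < p)%N -> 1 - m%:Z <= s <= m%:Z ->
    arrC p m a (2%:R *: delta_mx 0 i) s%:~R
| arrC_high (i : 'I_l) (s : int) :
    (p <= i)%N -> - m%:Z <= s <= m%:Z ->
    arrC p m a (2%:R *: delta_mx 0 i) s%:~R.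

(* Main.v *)
(* Put z = 1 and y_i = 2 x_i.  The basis comes from discrete integration.  Let
   A(s^2) be the even polynomial vanishing at s = +-y_j + e for all j and
   e = -(a-1), -(a-3), ..., a-1.  If F is an odd function such that
   F(s + 1) - F(s - 1) is a multiple of A(s^2), then F is constant on each chain
   y_j + {-a, -a+2, ..., a}; let f_j be its value there.  The chains of y_i and
   y_j (of y_i and -y_j) meet when y_i - y_j = 2 s (y_i + y_j = 2 s) with
   |s| <= a, so f_i = f_j (f_i = - f_j) on that hyperplane.  One takes
   F = N(s^2) M(s), with M an explicit product of linear factors or the inverse
   of such a product, depending on the sign of m - a, and N the solution of a
   triangular recurrence.  The poles of M do not survive in f_j, because
   F(y_j + a) = F(y_j - a); and f_j vanishes at y_j = s for |s| <= m, where either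
   M has a zero or the two sides of this equality have opposite signs.

   Integrating A(s^2) s^(2 k) for k < l - 1 gives the exponents c + 2 k + 1.  The
   element h obtained in the same way with m - 1 instead of m and k = 0, times
   \prod_j (y_j - m) \prod_(j >= p) (y_j + m), has degree c + 2 l - p - 1.  A
   combination of these derivations vanishing at a generic point comes from an N
   with more roots than its degree, so they are independent, and their
   homogenizations together with the Euler derivation satisfy Saito's criterion. *)

From HB Require Import structures.
Require Import Defs.
From mathcomp Require boolp.
From mathcomp Require Import all_boot all_order all_algebra.
From mathcomp Require Import perm ring lra zify.

Set Implicit Arguments.
Unset Strict Implicit.
Unset Printing Implicit Defensive.

Import Order.TTheory GRing.Theory Num.Theory.
Local Open Scope ring_scope.

(** * Substitution in multivariate polynomials *)

Lemma mpoly_ring_ind (n : nat) (R : comNzRingType)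
    (P : {mpoly R[n]} -> Prop) :
  (forall c, P c%:MP) -> (forall i, P 'X_i) ->
  (forall p q, P p -> P q -> P (p + q)) ->
  (forall p q, P p -> P q -> P (p * q)) ->
  forall p, P p.
Proof.
move=> PC PX PD PM p; rewrite (mpolyE p).
apply: (big_ind P) => //; first by rewrite -mpolyC0.
move=> m _; rewrite -mul_mpolyC; apply: (PM) => //.
rewrite mpolyXE_id; apply: (big_ind P); [by rewrite -mpolyC1|exact: PM|].
move=> i _; move: (m i) => e; elim: e => [|k IH]; first by rewrite expr0 -mpolyC1.
by rewrite exprS; apply: (PM).
Qed.

Lemma mpoly_morph_eq (n : nat) (R : comNzRingType) (T : comNzRingType)
    (f g : {rmorphism {mpoly R[n]} -> T}) :
  (forall c, f c%:MP = g c%:MP) -> (forall i, f 'X_i = g 'X_i) -> f =1 g.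
Proof.
move=> fgC fgX; elim/mpoly_ring_ind => // p q IHp IHq.
  by rewrite !rmorphD IHp IHq.
by rewrite !rmorphM IHp IHq.
Qed.

Section Substitution.
Variables (R : idomainType) (n : nat).
Implicit Types (p q b : {mpoly R[n]}) (i : 'I_n).

Definition msubst i b p : {mpoly R[n]} :=
  mmap (@mpolyC n R) (fun t => if t == i then b else 'X_t) p.

HB.instance Definition _ i b := GRing.RMorphism.copy (msubst i b)
  (mmap (@mpolyC n R) (fun t => if t == i then b else 'X_t)).

Lemma msubstC i b c : msubst i b c%:MP = c%:MP.
Proof. exact: mmapC. Qed.

Lemma msubstX i b t : msubst i b 'X_t = if t == i then b else 'X_t.
Proof. by rewrite /msubst mmapX mmap1U. Qed.

Lemma meval_msubst i b p (v : 'I_n -> R) :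
  (msubst i b p).@[v] = p.@[fun t => if t == i then b.@[v] else v t].
Proof.
move: p; apply: (@mpoly_morph_eq _ _ _ (meval v \o msubst i b)) => [c|t] /=.
  by rewrite msubstC !mevalC.
by rewrite msubstX mevalXU; case: eqP => // _; rewrite mevalXU.
Qed.

Lemma sub_msubst i b p : exists q, p - msubst i b p = ('X_i - b) * q.
Proof.
elim/mpoly_ring_ind: p => [c|t|p q [p' Ep] [q' Eq]|p q [p' Ep] [q' Eq]].
- by exists 0; rewrite msubstC subrr mulr0.
- rewrite msubstX; case: eqP => [->|_]; first by exists 1; rewrite mulr1.
  by exists 0; rewrite subrr mulr0.
- by exists (p' + q'); rewrite rmorphD mulrDr -Ep -Eq opprD addrACA.
- exists (p' * q + msubst i b p * q').
  rewrite rmorphM mulrDr mulrA -Ep [X in _ = _ + X]mulrCA -Eq.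
  by rewrite mulrBl mulrBr addrA subrK.
Qed.

Lemma msubst_dvd i b p :
  msubst i b p = 0 -> exists q, p = ('X_i - b) * q.
Proof. by move=> p0; have [q] := sub_msubst i b p; rewrite p0 subr0; exists q. Qed.

End Substitution.

Section Vanishing.
Variables (R : realFieldType) (n : nat).
Implicit Types (p q : {mpoly R[n]}).

Let small (r : R) := 0 < r < 2%:R^-1.

Lemma poly_eq0_on_seq (S : idomainType) (p : {poly S}) (e : nat -> S) :
  injective e -> (forall k, p.[e k] = 0) -> p = 0.
Proof.
move=> e_inj p0; apply/eqP; apply: contraT => pn0.
suff : (size [seq e k | k <- iota 0 (size p)] < size p)%N.
  by rewrite size_map size_iota ltnn.
apply: max_poly_roots => //; last by rewrite (map_inj_uniq e_inj) iota_uniq.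
by apply/allP => _ /mapP[k _ ->]; apply/rootP.
Qed.

Lemma mpoly_eq0_small p :
  (forall v, (forall i, small (v i)) -> p.@[v] = 0) -> p = 0.
Proof.
move=> p0.
pose h (T : seq 'I_n) v t : {mpoly R[n]} := if t \in T then (v t)%:MP else 'X_t.
pose sub (T : seq 'I_n) v := mmap (@mpolyC n R) (h T v).
suff H T v : (forall i, small (v i)) -> sub T v p = 0.
  have <- : sub [::] (fun=> 3%:R^-1) p = 0 by apply: H => i; rewrite /small; lra.
  apply/esym; move: p {p0 H}; apply: (@mpoly_morph_eq _ _ _ (sub _ _) idfun) => [c|t].
    by rewrite /sub /= mmapC.
  by rewrite /sub /= mmapX mmap1U.
have [U [TU fullU]] : exists U, {subset T <= T ++ U} /\ forall t, t \in T ++ U.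
  exists (enum 'I_n); split=> t; rewrite mem_cat; first by move->.
  by rewrite mem_enum orbT.
elim: U T v TU fullU => [|k U IH] T v TU fullU v_small.
  rewrite cats0 in fullU.
  suff -> : sub T v p = (p.@[v])%:MP by rewrite p0 ?mpolyC0.
  move: p {p0};
    apply: (@mpoly_morph_eq _ _ _ (sub _ _) (@mpolyC n R \o meval v)) => [c|t].
    by rewrite /sub /= mmapC mevalC.
  by rewrite /sub /= mmapX mmap1U mevalXU /h fullU.
have [kT|kT] := boolP (k \in T).
  apply: IH => // t; rewrite ?mem_cat; first by move->.
  have := fullU t; rewrite !mem_cat inE => /or3P[->|/eqP->|->] //.
    by rewrite kT.
  by rewrite orbT.
pose P := mmap (polyC \o @mpolyC n R)
  (fun t => if t == k then 'X else (h T v t)%:P).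
have PE q : (P p).[q] = mmap (@mpolyC n R)
    (fun t => if t == k then q else h T v t) p.
  move: (p); apply: (@mpoly_morph_eq _ _ _ (horner_eval q \o P)) => [c|t] /=.
    by rewrite /P /horner_eval !mmapC /= hornerC.
  rewrite /P /horner_eval !mmapX !mmap1U.
  by case: eqP => _; rewrite ?hornerX ?hornerC.
have P0 : P p = 0.
  apply: (@poly_eq0_on_seq _ _ (fun i => ((i%:R + 3%:R)^-1)%:MP)).
    move=> i j /eqP; rewrite mpolyC_eq => /eqP /invr_inj /addIr /eqP.
    by rewrite eqr_nat => /eqP.
  move=> i; rewrite PE.
  pose w t := if t == k then (i%:R + 3%:R)^-1 else v t.
  have w_small t : small (w t).
    rewrite /w; case: eqP => // _; rewrite /small invr_gt0.
    have i0 : 0 <= i%:R :> R by [].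
    by rewrite ltf_pV2 ?posrE; lra.
  have <- := IH (k :: T) w _ _ w_small.
  - move: (p); apply: (@mpoly_morph_eq _ _ _ (mmap _ _)) => [c|t].
      by rewrite /sub /= !mmapC.
    by rewrite /sub /= !mmapX !mmap1U /h /w inE; case: eqP.
  - by move=> t; rewrite mem_cat => ->.
  - move=> t; have := fullU t; rewrite !mem_cat !inE.
    by case: (t == k); rewrite ?orbT.
have := PE 'X_k; rewrite P0 horner0 => ->.
move: (p); apply: (@mpoly_morph_eq _ _ _ (sub _ _)) => [c|t].
  by rewrite /sub /= !mmapC.
by rewrite /sub /= !mmapX !mmap1U; case: eqP => // ->; rewrite /h (negPf kT).
Qed.

Lemma mpoly_dvd_small i b p :
  (forall v, (forall t, small (v t)) ->
     p.@[fun t => if t == i then b.@[v] else v t] = 0) ->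
  exists q, p = ('X_i - b) * q.
Proof.
move=> p0; apply: msubst_dvd; apply: mpoly_eq0_small => v v_small.
by rewrite meval_msubst p0.
Qed.

End Vanishing.

(** * Saito's criterion *)

Section Saito.
Variables (R : realType) (n : nat).
Implicit Types (p q : {mpoly R[n]}) (v w : 'rV[R]_n).

Definition mdvd p q := exists g, q = p * g.

Lemma mdvd_sum (I : Type) (r : seq I) (P : pred I) (F : I -> {mpoly R[n]}) p :
  (forall i, P i -> mdvd p (F i)) -> mdvd p (\sum_(i <- r | P i) F i).
Proof.
move=> pF; apply: (big_ind (mdvd p)) => //; first by exists 0; rewrite mulr0.
by move=> _ _ [g ->] [h ->]; exists (g + h); rewrite mulrDr.
Qed.

Lemma linear_form_eval v x : (linear_form v).@[x] = \sum_i v 0 i * x i.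
Proof.
rewrite /linear_form raddf_sum; apply: eq_bigr => i _ /=.
by rewrite mevalZ mevalXU.
Qed.

Lemma linear_form_homog v : linear_form v \is 1.-homog.
Proof. by apply: rpred_sum => i _; apply: rpredZ; rewrite dhomogX /= mdeg1. Qed.

Lemma linear_form_solve v i : v 0 i != 0 -> exists b,
  [/\ linear_form v = v 0 i *: ('X_i - b),
      msubst i b b = b & msubst i b (linear_form v) = 0].
Proof.
move=> vi0; pose b := \sum_(t | t != i) (- (v 0 t / v 0 i)) *: 'X_t : {mpoly R[n]}.
have lvE : linear_form v = v 0 i *: ('X_i - b).
  rewrite /linear_form (bigD1 i) //= scalerBr; congr (_ + _).
  rewrite /b -scaleNr scaler_sumr; apply: eq_bigr => t _.
  by rewrite scalerA mulrNN mulrCA mulfV // mulr1.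
have bb : msubst i b b = b.
  rewrite {2}/b raddf_sum /=; apply: eq_bigr => t /negPf ti.
  by rewrite -!mul_mpolyC rmorphM /= msubstC msubstX ti.
exists b; split=> //.
by rewrite lvE -mul_mpolyC rmorphM rmorphB /= bb msubstX eqxx subrr mulr0.
Qed.

Lemma rV_neq0P v : v != 0 -> exists i, v 0 i != 0.
Proof.
move=> v0; apply/existsP; apply: contra_neqT v0.
rewrite negb_exists => /forallP v0; apply/rowP => i; rewrite mxE.
by apply/eqP; rewrite -[_ == _]negbK; apply: v0.
Qed.

Lemma linear_form_prime v p q :
  v != 0 -> mdvd (linear_form v) (p * q) ->
  mdvd (linear_form v) p \/ mdvd (linear_form v) q.
Proof.
move=> /rV_neq0P[i vi0] [g pqE].
have [b [lvE _ lv0]] := linear_form_solve vi0.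
have dvd r : msubst i b r = 0 -> mdvd (linear_form v) r.
  move=> /msubst_dvd[h ->]; exists ((v 0 i)^-1 *: h).
  by rewrite lvE -scalerAl -scalerAr scalerA mulfV // scale1r.
have : msubst i b p * msubst i b q == 0 by rewrite -rmorphM pqE rmorphM /= lv0 mul0r.
by rewrite mulf_eq0 => /orP[] /eqP /dvd; [left|right].
Qed.

Lemma linear_form_dvd_scale v w :
  v != 0 -> mdvd (linear_form v) (linear_form w) -> exists c, w = c *: v.
Proof.
move=> /rV_neq0P[i vi0] [g wE]; exists (w 0 i / v 0 i).
apply/rowP => t; rewrite mxE.
have [->|ti] := eqVneq t i; first by rewrite divfK.
pose x s := if s == i then - v 0 t else if s == t then v 0 i else 0.
have lE u : (linear_form u).@[x] = u 0 t * v 0 i - u 0 i * v 0 t.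
  rewrite linear_form_eval (bigD1 i) //= (bigD1 t) //= big1 ?addr0.
    by rewrite /x !eqxx (negPf ti) addrC mulrN.
  by move=> s /andP[/negPf si /negPf st]; rewrite /x si st mulr0.
have := lE w; rewrite wE mevalM lE.
have -> : v 0 t * v 0 i - v 0 i * v 0 t = 0 by ring.
rewrite mul0r => /esym/eqP; rewrite subr_eq0 => /eqP E.
by apply: (mulIf vi0); rewrite E; field.
Qed.

Definition row_log (M : 'rV[{mpoly R[n]}]_n) v :=
  mdvd (linear_form v) (\sum_j M 0 j * (v 0 j)%:MP).

Lemma det_log_dvd (M : 'M[{mpoly R[n]}]_n) v :
  v != 0 -> (forall i, row_log (row i M) v) -> mdvd (linear_form v) (\det M).
Proof.
move=> /rV_neq0P[k vk0] Mlog.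
pose V : 'cV[{mpoly R[n]}]_n := \col_j (v 0 j)%:MP.
have : (\adj M *m (M *m V)) k 0 = \det M * (v 0 k)%:MP.
  by rewrite mulmxA mul_adj_mx mul_scalar_mx !mxE.
rewrite mxE => detE.
have [g gE] : mdvd (linear_form v) (\det M * (v 0 k)%:MP).
  rewrite -detE; apply: mdvd_sum => i _.
  have [h hE] := Mlog i; exists (\adj M k i * h).
  rewrite mulrCA; congr (_ * _); rewrite -hE mxE; apply: eq_bigr => j _.
  by rewrite !mxE.
exists ((v 0 k)^-1 *: g); rewrite -scalerAr -gE -mul_mpolyC mulrCA -mpolyCM.
by rewrite mulVf // mpolyC1 mulr1.
Qed.

Lemma dhomog_bigprod (I : Type) (r : seq I) (d : I -> nat) (G : I -> {mpoly R[n]}) :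
  (forall i, G i \is (d i).-homog) ->
  \prod_(i <- r) G i \is (\sum_(i <- r) d i)%N.-homog.
Proof.
move=> homogenize; elim: r => [|i r IH]; first by rewrite !big_nil dhomog1.
by rewrite !big_cons; apply: dhomogM.
Qed.

Lemma dhomog_msizeE d p : p != 0 -> p \is d.-homog -> msize p = d.+1.
Proof.
move=> p0 hp; have := dhomog_msize hp => /(dhomog_uniq p0 hp) ->.
by rewrite prednK // lt0n msize_poly_eq0.
Qed.

Section Forms.
Variables (T : eqType) (s : seq T) (F : T -> 'rV[R]_n).
Hypothesis s_uniq : uniq s.
Hypothesis F_neq0 : {in s, forall t, F t != 0}.
Hypothesis F_indep : {in s &, forall t t' c, F t' = c *: F t -> t = t'}.

Lemma linear_forms_prod_dvd p :
  {in s, forall t, mdvd (linear_form (F t)) p} ->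
  mdvd (\prod_(t <- s) linear_form (F t)) p.
Proof.
elim: s s_uniq F_neq0 F_indep => [|t r IH] /=.
  by move=> _ _ _ _; exists p; rewrite big_nil mul1r.
move=> /andP[tr r_uniq] F0 Fi dvd.
have sub u : u \in r -> u \in t :: r by rewrite inE => ->; rewrite orbT.
have [] := IH r_uniq.
- by move=> u /sub; apply: F0.
- by move=> u u' /sub ur /sub u'r; apply: Fi.
- by move=> u /sub; apply: dvd.
move=> g pE; have t_in : t \in t :: r by rewrite inE eqxx.
have := dvd t t_in; rewrite pE => /(linear_form_prime (F0 _ t_in)) [|[h ->]]; last first.
  by exists h; rewrite big_cons mulrA [X in X * h]mulrC.
rewrite big_seq => H; exfalso; move: H.
apply: (big_ind (fun x => ~ mdvd (linear_form (F t)) x)).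
- move=> [h /(congr1 (meval (fun=> 0)))]; rewrite meval1 mevalM linear_form_eval.
  rewrite big1 ?mul0r; last by move=> i _; rewrite mulr0.
  by move/eqP; rewrite oner_eq0.
- by move=> x y nx ny /(linear_form_prime (F0 _ t_in)) [].
- move=> u ur /(linear_form_dvd_scale (F0 _ t_in)) [c /(Fi _ _ t_in (sub _ ur))].
  by move=> tu; move: tr; rewrite tu ur.
Qed.

Section Basis.
Variables (M : 'M[{mpoly R[n]}]_n) (d : 'I_n -> nat).
Hypothesis M_log : forall i, {in s, forall t, row_log (row i M) (F t)}.
Hypothesis M_homog : forall i j, M i j \is (d i).-homog.
Hypothesis sum_d : (\sum_i d i = size s)%N.
Hypothesis det_neq0 : \det M != 0.

Let Q := \prod_(t <- s) linear_form (F t).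

Lemma det_saito : exists2 c, c != 0 & \det M = c *: Q.
Proof.
have [g gE] : mdvd Q (\det M).
  by apply: linear_forms_prod_dvd => t ts; apply: det_log_dvd => [|i];
     [exact: F_neq0|exact: M_log].
have Q0 : Q != 0 by apply: contraNneq det_neq0 => Q0; rewrite gE Q0 mul0r.
have g0 : g != 0 by apply: contraNneq det_neq0 => g0; rewrite gE g0 mulr0.
have det_hom : \det M \is (size s).-homog.
  rewrite -sum_d; apply: rpred_sum => sg _; rewrite -signr_odd.
  suff H : \prod_i M i (sg i) \is (\sum_i d i)%N.-homog.
    by case: (odd _); rewrite ?expr1 ?expr0 ?mulN1r ?mul1r ?rpredN.
  by apply: dhomog_bigprod.
have Q_hom : Q \is (size s).-homog.
  by rewrite -sum1_size; apply: dhomog_bigprod => t; apply: linear_form_homog.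
have := dhomog_msizeE det_neq0 det_hom; rewrite gE msizeM //.
rewrite (dhomog_msizeE Q0 Q_hom) addSn /= -addn1 => /addnI /eqP.
by move=> /msize_poly1P[c c0 ->]; exists c => //; rewrite mulrC mul_mpolyC.
Qed.

Lemma row_log_span (D : 'rV[{mpoly R[n]}]_n) :
  {in s, forall t, row_log D (F t)} -> exists f : 'rV_n, D = f *m M.
Proof.
move=> Dlog; have [c c0 detE] := det_saito.
have /fin_all_exists [f fE] i : exists g, (D *m \adj M) 0 i = \det M * g.
  pose M' := \matrix_(k, j) (if k == i then D 0 j else M k j).
  have -> : (D *m \adj M) 0 i = \det M'.
    rewrite (expand_det_row _ i) mxE; apply: eq_bigr => j _.
    rewrite !mxE eqxx; congr (_ * (_ * \det _)); apply/matrixP => a b.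
    by rewrite !mxE eq_sym (negPf (neq_lift _ _)).
  have [g ->] : mdvd Q (\det M').
    apply: linear_forms_prod_dvd => t ts; apply: det_log_dvd => [|k].
      exact: F_neq0.
    have [ki|ki] := eqVneq k i.
      have -> : row k M' = D by apply/rowP => j; rewrite !mxE ki eqxx.
      exact: Dlog.
    have -> : row k M' = row k M by apply/rowP => j; rewrite !mxE (negPf ki).
    exact: M_log.
  exists (c^-1 *: g); rewrite detE -scalerAl -scalerAr scalerA mulfV //.
  by rewrite scale1r.
exists (\row_i f i).
have E : D *m \adj M = \det M *: \row_i f i by apply/rowP => i; rewrite fE !mxE.
have : \det M *: D = \det M *: (\row_i f i *m M).
  by rewrite scalemxAl -E -mulmxA mul_adj_mx mul_mx_scalar.
move/matrixP => H; apply/rowP => j; have := H 0 j.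
by rewrite mxE [in RHS]mxE => /(mulfI det_neq0).
Qed.

Lemma mulmx_row_eq0 (f : 'rV[{mpoly R[n]}]_n) : f *m M = 0 -> f = 0.
Proof.
move=> fM; have : \det M *: f = 0.
  by rewrite -mul_mx_scalar -mul_mx_adj mulmxA fM mul0mx.
by move=> /eqP; rewrite scalemx_eq0 (negPf det_neq0) => /eqP.
Qed.

End Basis.
End Forms.

Section Derivation.
Variable c : 'I_n -> {mpoly R[n]}.

Definition der_of_fun p : {mpoly R[n]} := \sum_i c i * p^`M(i).

Fact der_of_linear : linear der_of_fun.
Proof.
move=> a p q; rewrite /der_of_fun scaler_sumr -big_split /=.
apply: eq_bigr => i _.
by rewrite linearP mulrDr scalerAr.
Qed.

HB.instance Definition _ :=
  GRing.isLinear.Build R {mpoly R[n]} {mpoly R[n]} _ der_of_fun der_of_linear.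

Fact der_of_leibniz p q :
  der_of_fun (p * q) = der_of_fun p * q + p * der_of_fun q.
Proof.
rewrite /der_of_fun mulr_suml mulr_sumr -big_split /=.
by apply: eq_bigr => i _; rewrite mderivM; ring.
Qed.

Definition der_of : der R n := Der der_of_leibniz.

Lemma der_ofX i : der_of 'X_i = c i.
Proof.
rewrite /= /der_of_fun (bigD1 i) //= big1 => [|j ji].
  by rewrite mderivX mnmE eqxx scale1r (_ : _ - _ = 0)%MM ?mpolyX0 ?mulr1 ?addr0 //;
    apply/mnmP => j; rewrite !mnmE subnn.
by rewrite mderivX mnmE eq_sym (negPf ji) scale0r mulr0.
Qed.

End Derivation.

Lemma derC (D : der R n) c : D c%:MP = 0.
Proof.
rewrite -[c%:MP]mulr1 mul_mpolyC linearZ /=.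
have := der_leibniz D 1 1; rewrite !mulr1 mul1r => /eqP.
by rewrite -subr_eq subrr eq_sym => /eqP ->; rewrite scaler0.
Qed.

Lemma derE (D : der R n) p : D p = \sum_i D 'X_i * p^`M(i).
Proof.
rewrite -/(der_of_fun (fun i => D 'X_i) p).
elim/mpoly_ring_ind: p => [c|i|p q IHp IHq|p q IHp IHq].
- by rewrite derC -[RHS]/(der_of _ _) derC.
- by rewrite -[RHS]/(der_of _ _) der_ofX.
- by rewrite !linearD IHp IHq.
- by rewrite der_leibniz der_of_leibniz IHp IHq.
Qed.

Lemma der_linear_form (D : der R n) v :
  D (linear_form v) = \sum_j D 'X_j * (v 0 j)%:MP.
Proof.
rewrite /linear_form linear_sum; apply: eq_bigr => j _.
by rewrite linearZ /= mulrC mul_mpolyC.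
Qed.

Lemma saito_criterion (A : central_arrangement R n) (T : eqType) (s : seq T)
    (F : T -> 'rV[R]_n) (e : seq nat) (M : 'M[{mpoly R[n]}]_n) :
  uniq s -> {in s, forall t, F t != 0} ->
  {in s &, forall t t' c, F t' = c *: F t -> t = t'} ->
  {in s, forall t, A (F t)} ->
  (forall v, A v -> forall i, row_log (row i M) v) ->
  (forall i j, M i j \is (nth 0%N e i).-homog) ->
  size e = n -> sumn e = size s -> \det M != 0 ->
  has_exponents A e.
Proof.
move=> s_uniq F0 Fi FA Mlog Mhom se sum_e det0.
have Mlog' i : {in s, forall t, row_log (row i M) (F t)}.
  by move=> t /FA Ft; apply: Mlog.
have sum_d : (\sum_(i < n) nth 0%N e i = size s)%N.
  by rewrite -sum_e sumnE (big_nth 0%N) big_mkord se.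
pose th i := der_of (M i).
have thX i j : th i 'X_j = M i j by rewrite der_ofX.
suff H k : k = n -> exists theta : 'I_k -> der R n,
    log_basis A theta /\ forall i : 'I_k, homogeneous_der (nth 0%N e i) (theta i).
  exact: H se.
move=> kn; subst k; exists th; split; last first.
  by move=> i j; rewrite thX; apply: Mhom.
split.
- move=> i v Av; have [g gE] := Mlog v Av i; exists g.
  rewrite der_linear_form -gE; apply: eq_bigr => j _.
  by rewrite thX mxE.
- move=> D Dlog.
  have [|f fE] := row_log_span s_uniq F0 Fi Mlog' Mhom sum_d det0
    (D := \row_j D 'X_j).
    move=> t ts; have [g gE] := Dlog _ (FA _ ts); exists g.
    rewrite -gE der_linear_form; apply: eq_bigr => j _.
    by rewrite mxE.
  exists (f 0) => p; rewrite derE.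
  under [RHS]eq_bigr => i _ do rewrite derE mulr_sumr.
  rewrite exchange_big /=; apply: eq_bigr => j _.
  have /rowP/(_ j) := fE; rewrite !mxE => ->; rewrite mulr_suml.
  by apply: eq_bigr => i _; rewrite thX mulrA.
- move=> f f0 i.
  suff /rowP/(_ i) : \row_i f i = 0 by rewrite !mxE.
  apply: (@mulmx_row_eq0 M det0).
  apply/rowP => j; rewrite !mxE -[RHS](f0 'X_j).
  by apply: eq_bigr => k _; rewrite thX mxE.
Qed.

Lemma has_exponents_free (A : central_arrangement R n) e :
  has_exponents A e -> free_arrangement A.
Proof. by case=> theta [basis _]; exists (size e), theta. Qed.

End Saito.

(** * Homogenization and cones *)

Section Homogenization.
Variables (R : realType) (l : nat).
Implicit Types (p : {mpoly R[l]}) (q : {mpoly R[l + 1]}).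

Definition dehomogenize_var (t : 'I_(l + 1)) : {mpoly R[l]} :=
  if split t is inl i then 'X_i else 1.

Definition dehomogenize q : {mpoly R[l]} :=
  mmap (@mpolyC l R) dehomogenize_var q.

HB.instance Definition _ :=
  GRing.RMorphism.copy dehomogenize (mmap (@mpolyC l R) dehomogenize_var).

Definition affine_point (v : 'I_l -> R) (t : 'I_(l + 1)) : R :=
  if split t is inl i then v i else 1.

Lemma dehomogenizeX t : dehomogenize 'X_t = dehomogenize_var t.
Proof. by rewrite /dehomogenize mmapX mmap1U. Qed.

Lemma split_lshift (i : 'I_l) : split (lshift 1 i) = inl i.
Proof. exact: (unsplitK (inl _ i)). Qed.

Lemma split_rshift (i : 'I_1) : split (rshift l i) = inr i.
Proof. exact: (unsplitK (inr _ i)). Qed.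

Lemma meval_dehomogenize v q : (dehomogenize q).@[v] = q.@[affine_point v].
Proof.
move: q; apply: (@mpoly_morph_eq _ _ _ (meval v \o dehomogenize)) => [c|t] /=.
  by rewrite /dehomogenize mmapC !mevalC.
rewrite dehomogenizeX mevalXU /affine_point /dehomogenize_var; case: (split t) => [i|_].
  by rewrite mevalXU.
by rewrite meval1.
Qed.

Definition homogenize (d : nat) p : {mpoly R[l + 1]} :=
  \sum_(m <- msupp p) p@_m *: ((\prod_(i < l) 'X_(lshift 1 i) ^+ m i) *
    'X_(rshift l ord0) ^+ (d - mdeg m)).

Lemma dehomogenizeK d p : dehomogenize (homogenize d p) = p.
Proof.
rewrite [RHS](mpolyE p) /homogenize raddf_sum /=; apply: eq_bigr => m _.
rewrite -mul_mpolyC rmorphM /= {1}/dehomogenize mmapC mul_mpolyC; congr (_ *: _).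
rewrite rmorphM rmorphXn /= dehomogenizeX /dehomogenize_var split_rshift expr1n mulr1 mpolyXE_id.
rewrite rmorph_prod; apply: eq_bigr => i _.
by rewrite rmorphXn /= dehomogenizeX /dehomogenize_var split_lshift.
Qed.

Lemma homogenize_homog d p : (msize p <= d.+1)%N -> homogenize d p \is d.-homog.
Proof.
move=> pd; rewrite /homogenize big_seq; apply: rpred_sum => m mp; apply: rpredZ.
have md : (mdeg m <= d)%N by rewrite -ltnS (leq_trans _ pd) // msize_mdeg_lt.
have X_hom (t : 'I_(l + 1)) e : ('X_t ^+ e : {mpoly R[l + 1]}) \is e.-homog.
  by rewrite -{2}[e]mul1n; apply: dhomogMn; rewrite dhomogX /= mdeg1.
set f := _ * _; suff : f \is (mdeg m + (d - mdeg m)).-homog by rewrite subnKC.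
by apply: dhomogM => //; rewrite mdegE; apply: dhomog_bigprod => i.
Qed.

Lemma dhomog_meval_scale (n d : nat) (f : {mpoly R[n]}) c x :
  f \is d.-homog -> f.@[fun t => c * x t] = c ^+ d * f.@[x].
Proof.
move=> /dhomogP fd; rewrite !mevalE mulr_sumr big_seq [RHS]big_seq.
apply: eq_bigr => m mf; rewrite mulrCA; congr (_ * _).
rewrite -(fd _ mf) /= mdegE -prodrXr -big_split /=.
by apply: eq_bigr => i _; rewrite exprMn.
Qed.

Lemma dehomogenize_inj d q : q \is d.-homog -> dehomogenize q = 0 -> q = 0.
Proof.
move=> qd q0; apply: mpoly_eq0_small => x x_small.
set z := x (rshift l ord0).
have z0 : z != 0 by have /andP[/gt_eqF ->] := x_small (rshift l ord0).
have -> : q.@[x] = q.@[fun t => z * affine_point (fun i => x (lshift 1 i) / z) t].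
  apply: meval_eq => t; rewrite /affine_point -{1}(splitK t).
  case: (split t) => i /=; first by rewrite mulrCA mulfV ?mulr1.
  by rewrite mulr1 /z (ord1 i).
by rewrite (dhomog_meval_scale _ _ qd) -meval_dehomogenize q0 meval0 mulr0.
Qed.

Definition affine_form (v : 'rV[R]_l) (d : R) : {mpoly R[l]} :=
  \sum_i v 0 i *: 'X_i - d%:MP.

Lemma dehomogenize_linear_form v d :
  dehomogenize (linear_form (row_mx v (const_mx (- d)))) = affine_form v d.
Proof.
rewrite /linear_form big_split_ord /= rmorphD !raddf_sum /= big_ord1.
congr (_ + _).
  apply: eq_bigr => i _; rewrite -!mul_mpolyC rmorphM /= dehomogenizeX /dehomogenize_var split_lshift.
  by rewrite {1}/dehomogenize mmapC row_mxEl.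
rewrite -!mul_mpolyC rmorphM /= dehomogenizeX /dehomogenize_var split_rshift mulr1 /dehomogenize mmapC.
by rewrite row_mxEr mxE; exact: mpolyCN.
Qed.

Lemma affine_form_msize v d : v != 0 -> (1 < msize (affine_form v d))%N.
Proof.
move=> /rV_neq0P[i vi]; rewrite ltnNge; apply: contraNN vi => /msize1_polyC E.
have := congr1 (mcoeff U_(i)) E.
rewrite mcoeffB !mcoeffC mnm1_eq0 !mulr0 subr0 raddf_sum /= (bigD1 i) //=.
rewrite mcoeffZ mcoeffX eqxx mulr1 big1 ?addr0 => [->//|j ji].
rewrite mcoeffZ mcoeffX; have [E2|_] := eqP; last by rewrite mulr0.
have := congr1 (fun m : 'X_{1..l} => m j) E2.
by rewrite /= !mnmE eqxx eq_sym (negPf ji).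
Qed.

Definition homogenize_row (d : nat) (c : 'I_l -> {mpoly R[l]}) :
    'rV[{mpoly R[l + 1]}]_(l + 1) :=
  \row_t if split t is inl i then homogenize d (c i) else 0.

Lemma homogenize_row_log d c v e :
  v != 0 -> (forall i, (msize (c i) <= d.+1)%N) ->
  mdvd (affine_form v e) (\sum_i v 0 i *: c i) ->
  row_log (homogenize_row d c) (row_mx v (const_mx (- e))).
Proof.
move=> v0 cd [g gE].
set al := row_mx _ _; rewrite /row_log; set s := \sum_j _.
have sE : s = \sum_i (v 0 i)%:MP * homogenize d (c i).
  rewrite /s big_split_ord /= big_ord1 mxE split_rshift mul0r addr0.
  by apply: eq_bigr => i _; rewrite mxE split_lshift mulrC row_mxEl.
have s_hom : s \is d.-homog.
  rewrite sE; apply: rpred_sum => i _; rewrite mul_mpolyC; apply: rpredZ.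
  exact: homogenize_homog.
have ds : dehomogenize s = affine_form v e * g.
  rewrite sE -gE raddf_sum; apply: eq_bigr => i _ /=.
  by rewrite rmorphM /= dehomogenizeK {1}/dehomogenize mmapC mul_mpolyC.
have [g0|g0] := eqVneq g 0.
  exists 0; rewrite mulr0; apply: dehomogenize_inj s_hom _.
  by rewrite ds g0 mulr0.
have af := affine_form_msize e v0.
have af0 : affine_form v e != 0 by rewrite -msize_poly_eq0 -lt0n ltnW.
have gd : (msize g < d.+1)%N.
  have : (msize (affine_form v e * g) <= d.+1)%N.
    rewrite -gE; apply: leq_trans (msize_sum _ _ _) _; apply/bigmax_leqP => i _.
    exact: leq_trans (msizeZ_le _ _) (cd i).
  rewrite msizeM //; apply: leq_trans.
  by case: (msize (affine_form v e)) af => [|[|k]] // _; rewrite !addSn /= ltnS leq_addl.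
have d0 : (0 < d)%N by rewrite (leq_trans _ (gd : (msize g <= d)%N)) // lt0n msize_poly_eq0.
exists (homogenize d.-1 g); apply/eqP; rewrite -subr_eq0; apply/eqP.
apply: (@dehomogenize_inj d).
  apply: rpredB => //.
  suff : linear_form al * homogenize d.-1 g \is (1 + d.-1).-homog by rewrite add1n prednK.
  apply: dhomogM; first exact: linear_form_homog.
  by apply: homogenize_homog; rewrite prednK.
by rewrite rmorphB rmorphM /= dehomogenizeK ds dehomogenize_linear_form subrr.
Qed.

Definition cone_matrix (d : nat -> nat) (c : nat -> 'I_l -> {mpoly R[l]}) :
    'M[{mpoly R[l + 1]}]_(l + 1) :=
  \matrix_(i, j) if (i : nat) is k.+1 then homogenize_row (d k) (c k) 0 j else 'X_j.

Lemma cone_matrix_row d (c : nat -> 'I_l -> {mpoly R[l]}) (i : 'I_(l + 1)) v :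
  (forall k, (k < l)%N -> row_log (homogenize_row (d k) (c k)) v) ->
  row_log (row i (cone_matrix d c)) v.
Proof.
move=> H; case Ei : (val i) => [|k].
  exists 1; rewrite mulr1; apply: eq_bigr => j _.
  by rewrite !mxE /= Ei mulrC mul_mpolyC.
have kl : (k < l)%N by have := ltn_ord i; rewrite /= in Ei *; rewrite Ei addn1.
have [g gE] := H k kl; exists g; rewrite -gE; apply: eq_bigr => j _.
by rewrite !mxE Ei mxE.
Qed.

Lemma cone_matrix_det d (c : nat -> 'I_l -> {mpoly R[l]}) (v : 'I_l -> R) :
  (forall b : nat -> R,
     (forall t, \sum_(k < l) b k * (c k t).@[v] = 0) ->
     forall k, (k < l)%N -> b k = 0) ->
  \det (cone_matrix d c) != 0.
Proof.
move=> indep; apply/eqP => det0.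
have : \det (map_mx (meval (affine_point v)) (cone_matrix d c)) == 0.
  by rewrite det_map_mx det0 rmorph0.
move=> /det0P[u /rV_neq0P[i ui] uM].
pose b k := oapp (u 0) 0 (insub k : option 'I_(l + 1)).
have bE k : u 0 k = b k by rewrite /b valK.
pose C k t := if k is k.+1 then
  if split t is inl i then (c k i).@[v] else 0 else affine_point v t.
have sumE t : \sum_(k < l + 1) b k * C k t = 0.
  have /rowP/(_ t) := uM; rewrite !mxE => E; rewrite -[RHS]E; apply: eq_bigr => k _.
  rewrite bE !mxE; congr (_ * _); case: (nat_of_ord k) => [|k'] /=.
    by rewrite mevalXU.
  rewrite mxE; case: (split t) => j; last by rewrite meval0.
  by rewrite -meval_dehomogenize dehomogenizeK.
have sumE' t : b 0%N * affine_point v t + \sum_(k < l) b k.+1 * C k.+1 t = 0.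
  rewrite -[RHS](sumE t) -(big_mkord xpredT (fun k => b k * C k t)) addn1.
  by rewrite [RHS]big_nat_recl // big_mkord.
have b0 : b 0%N = 0.
  have := sumE' (rshift l ord0); rewrite /affine_point split_rshift mulr1.
  by rewrite big1 ?addr0 // => k _; rewrite /= split_rshift mulr0.
suff H k : (k < l)%N -> b k.+1 = 0.
  move: ui; rewrite bE; case Ei : (nat_of_ord i) => [|k]; first by rewrite b0 eqxx.
  have kl : (k < l)%N by have := ltn_ord i; rewrite Ei addn1.
  by rewrite H ?eqxx.
apply: (indep (fun k => b k.+1)) => t.
by have := sumE' (lshift 1 t); rewrite b0 mul0r add0r /= split_lshift.
Qed.

End Homogenization.

(** * Discrete integration *)

Section CenteredProduct.
Variable T : comNzRingType.
Implicit Types (s : T) (k : nat).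

Definition cprod k s : T := \prod_(i < k.*2.-1) (s + (i%:R - k.-1%:R)).

Lemma cprod0 s : cprod 0 s = 1.
Proof. by rewrite /cprod big_ord0. Qed.

Lemma cprod_step k s :
  cprod k.+1 (s + 1) * ((s - k.+1%:R) * (s - k%:R)) =
  cprod k.+1 (s - 1) * ((s + k.+1%:R) * (s + k%:R)).
Proof.
pose g (i : nat) : T := s - 1 + (i%:R - k%:R).
have E1 : cprod k.+1 (s + 1) = \prod_(i < k.*2.+1) g i.+2.
  apply: eq_bigr => i _; rewrite /g /= -!(addn1 i.+1) -(addn1 i) !natrD; ring.
have E2 : cprod k.+1 (s - 1) = \prod_(i < k.*2.+1) g i by [].
have E : g 0%N * (g 1%N * \prod_(i < k.*2.+1) g i.+2) =
    \prod_(i < k.*2.+1) g i * g k.*2.+1 * g k.*2.+2.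
  rewrite -!(big_mkord xpredT g) -(big_mkord xpredT (fun i => g i.+2)).
  transitivity (\prod_(0 <= i < k.*2.+3) g i).
    by rewrite [RHS]big_nat_recl // [in RHS]big_nat_recl.
  by rewrite big_nat_recr //= [in LHS]big_nat_recr.
rewrite -E1 -E2 in E.
have g0 : g 0%N = s - k.+1%:R by rewrite /g -addn1 natrD; ring.
have g1 : g 1%N = s - k%:R by rewrite /g; ring.
have g2 : g k.*2.+1 = s + k%:R by rewrite /g -addn1 -addnn !natrD; ring.
have g3 : g k.*2.+2 = s + k.+1%:R.
  by rewrite /g -addn2 -addnn -(addn1 k) !natrD; ring.
by move: E; rewrite g0 g1 g2 g3 => E; rewrite mulrC -mulrA E; ring.
Qed.

Lemma cprod_opp k s : cprod k.+1 (- s) = - cprod k.+1 s.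
Proof.
rewrite /cprod /= (reindex_inj rev_ord_inj) /=.
under eq_bigr => i _.
  have -> : - s + ((k.*2.+1 - i.+1)%:R - k%:R) = - (s + (i%:R - k%:R)).
    have ik : (i <= k.*2)%N by rewrite -ltnS.
    have E : k.*2%:R = k%:R + k%:R :> T by rewrite -natrD addnn.
    by rewrite subSS natrB // E; ring.
  over.
rewrite prodrN card_ord -signr_odd /= odd_double /= expr1 mulN1r.
by [].
Qed.

Lemma cprod_root k s (i : nat) :
  (i < k.*2.-1)%N -> s = k.-1%:R - i%:R -> cprod k s = 0.
Proof.
move=> ik ->; rewrite /cprod (bigD1 (Ordinal ik)) //=.
by rewrite [X in X * _](_ : _ = 0) ?mul0r //=; ring.
Qed.

End CenteredProduct.

Lemma rmorph_cprod (T U : comNzRingType) (f : {rmorphism T -> U}) k s :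
  f (cprod k s) = cprod k (f s).
Proof.
rewrite /cprod rmorph_prod; apply: eq_bigr => i _.
by rewrite rmorphD rmorphB !rmorph_nat.
Qed.

Lemma size_mulXsubC (T : nzRingType) (c : T) (p : {poly T}) :
  (size (p * ('X - c%:P))%R <= (size p).+1)%N /\
  (p != 0 -> size (p * ('X - c%:P)) = (size p).+1).
Proof.
have H : p != 0 -> size (p * ('X - c%:P)) = (size p).+1.
  by move=> p0; rewrite size_Mmonic ?monicXsubC // size_XsubC addn2.
split=> //; have [->|/H -> //] := eqVneq p 0.
by rewrite mul0r size_poly0.
Qed.

Section Recurrence.
Variable R : realFieldType.
Implicit Types (s y nu : R) (N W : {poly R}) (n a : nat).

Definition recurrence nu N W := forall s,
  (s + nu) * (s + nu + 1) * N.[(s + 1) ^+ 2] -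
  (s - nu) * (s - nu - 1) * N.[(s - 1) ^+ 2] = s * W.[s ^+ 2].

(* L_nu ((s^2 - (nu+1)^2) N) = (s^2 - nu^2) L_(nu+1) N, where L_nu N is the
   left-hand side of the recurrence: dividing W by u - nu^2 lowers its degree. *)
Lemma recurrence_shift nu N W :
  recurrence (nu + 1) N W ->
  recurrence nu (('X - ((nu + 1) ^+ 2)%:P) * N) (('X - (nu ^+ 2)%:P) * W).
Proof.
move=> NW s; rewrite !hornerM !hornerXsubC.
rewrite [RHS](_ : _ = (s ^+ 2 - nu ^+ 2) * (s * W.[s ^+ 2])); last by ring.
by rewrite -NW; ring.
Qed.

Lemma recurrence_solve k nu W :
  (size W <= k)%N -> (forall j : nat, 2%:R * nu + j.*2.+1%:R != 0) ->
  exists2 N : {poly R}, (size N <= k)%N & recurrence nu N W.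
Proof.
elim: k nu W => [|k IH] nu W Wk odd_nu.
  exists 0; first by rewrite size_poly0.
  move: Wk; rewrite leqn0 size_poly_eq0 => /eqP -> s.
  by rewrite !horner0; ring.
pose w := W.[nu ^+ 2].
have [W1 W1E] : exists W1, W - w%:P = W1 * ('X - (nu ^+ 2)%:P).
  by apply/factor_theorem; rewrite rootE !hornerE subrr.
have W1k : (size W1 <= k)%N.
  have [->|W10] := eqVneq W1 0; first by rewrite size_poly0.
  rewrite -ltnS -((size_mulXsubC (nu ^+ 2) _).2 W10) -W1E.
  rewrite (leq_trans (size_polyD _ _)) // size_polyN geq_max Wk.
  by rewrite (leq_trans (size_polyC_leq1 _)).
have odd_nu1 (j : nat) : 2%:R * (nu + 1) + j.*2.+1%:R != 0.
  rewrite (_ : _ + _ = 2%:R * nu + j.+1.*2.+1%:R) ?odd_nu //.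
  by rewrite doubleS -!(addn1 _.+1) -!(addn1 j.*2) !natrD; ring.
have [N1 N1k N1E] := IH (nu + 1) W1 W1k odd_nu1.
have nu0 := odd_nu 0%N; rewrite /= in nu0.
exists ((w / (2%:R * (2%:R * nu + 1)))%:P + ('X - ((nu + 1) ^+ 2)%:P) * N1).
  rewrite (leq_trans (size_polyD _ _)) // geq_max.
  rewrite (leq_trans (size_polyC_leq1 _)) //=.
  by rewrite mulrC (leq_trans (size_mulXsubC _ _).1).
move=> s; have := recurrence_shift N1E s.
rewrite [_ * W1]mulrC -W1E !hornerE => E.
have -> : s * W.[s ^+ 2] = s * (W.[s ^+ 2] - w) + s * w by ring.
rewrite -E /=; field.
by [].
Qed.

End Recurrence.

Section Levels.
Variable R : realFieldType.
Variables n a : nat.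
Implicit Types (s y : R) (N W : {poly R}).

Definition nonint s := forall z : int, s != z%:~R.

Lemma nonintDz s (z : int) : nonint s -> nonint (s + z%:~R).
Proof.
move=> sni z'; rewrite -subr_eq0 (_ : _ - _ = s - (z' - z)%:~R).
  by rewrite subr_eq0 sni.
by rewrite rmorphB /=; ring.
Qed.

Lemma nonintN s : nonint s -> nonint (- s).
Proof. by move=> sni z; rewrite eqr_oppLR -rmorphN /= sni. Qed.

Lemma cprod_neq0 k s : nonint s -> cprod k s != 0.
Proof.
move=> sni; apply/prodf_neq0 => i _.
have := nonintDz ((i : nat)%:Z - (k.-1)%:Z) sni 0.
by rewrite rmorphB /= !pmulrn.
Qed.

Lemma cprod_gt0 k s : k%:R < s + 1 -> 0 < cprod k s.
Proof.
move=> ks; apply: prodr_gt0 => i _.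
have i0 : 0 <= i%:R :> R by [].
case: k ks i i0 => [|k] ks i i0; first by have := ltn_ord i.
by move: ks; rewrite -natr1 /=; lra.
Qed.

(* With nu = n - 1 - a, the quotient M = numer / denom is
   \prod_(|i| <= nu) (s + i) if nu >= 0 and 1 / \prod_(|i| < - nu) (s + i) if
   nu < 0.  The recurrence with parameter nu says that the increment of
   N(s^2) M(s) from s - 1 to s + 1 is proportional to W(s^2). *)
Definition numer s : R := cprod (n - a) s.
Definition denom s : R := cprod (a.+1 - n) s.

Definition level : R := n%:R - 1 - a%:R.

Definition primitive N s := N.[s ^+ 2] * (numer s / denom s).

Lemma level_odd (j : nat) : 2%:R * level + j.*2.+1%:R != 0.
Proof.
apply/eqP; rewrite /level => H.
have /eqP : (n + j).*2%:R = a.*2.+1%:R :> R.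
  by move: H; rewrite -(addn1 j.*2) -(addn1 a.*2) -!addnn !natrD; lra.
by rewrite eqr_nat => /eqP /(congr1 odd); rewrite /= !odd_double.
Qed.

Lemma numer_denom_step s :
  numer (s + 1) * denom (s - 1) * ((s - level) * (s - level - 1)) =
  numer (s - 1) * denom (s + 1) * ((s + level) * (s + level + 1)).
Proof.
rewrite /numer /denom /level; have [na|an] := leqP n a.
  have [j ->] : exists j, a = (n + j)%N by exists (a - n)%N; rewrite subnKC.
  rewrite subnDA subnn sub0n -addnS addKn !cprod0 natrD.
  have := cprod_step j s; rewrite -natr1 => E.
  rewrite [LHS](_ : _ = cprod j.+1 (s - 1) * ((s + (j%:R + 1)) * (s + j%:R))); last by ring.
  by rewrite -E; ring.
have [j ->] : exists j, n = (a + j.+1)%N.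
  by exists (n - a.+1)%N; rewrite -subSn // subSS subnKC // ltnW.
rewrite addKn -addSnnS subnDA subnn sub0n !cprod0 !natrD.
have := cprod_step j s; rewrite -natr1 => E.
rewrite [LHS](_ : _ = cprod j.+1 (s + 1) * ((s - (j%:R + 1)) * (s - j%:R))); last by ring.
by rewrite E; ring.
Qed.


Lemma numer_denom_opp s :
  (numer (- s) = - numer s /\ denom (- s) = denom s) \/
  (numer (- s) = numer s /\ denom (- s) = - denom s).
Proof.
rewrite /numer /denom; have [na|an] := leqP n a.
  right; rewrite subSn // cprod_opp; split=> //.
  by move: na; rewrite -subn_eq0 => /eqP ->; rewrite !cprod0.
left; rewrite -(subnSK an) cprod_opp; split=> //.
by move: an; rewrite -subn_eq0 => /eqP ->; rewrite !cprod0.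
Qed.

Lemma primitive_opp N s : primitive N (- s) = - primitive N s.
Proof.
rewrite /primitive sqrrN.
by case: (numer_denom_opp s) => -[-> ->]; rewrite ?invrN; ring.
Qed.

Lemma primitive_step N W s :
  recurrence level N W -> W.[s ^+ 2] = 0 -> nonint s ->
  primitive N (s + 1) = primitive N (s - 1).
Proof.
move=> NW Ws sni; have := NW s; rewrite Ws mulr0 => /eqP.
rewrite subr_eq0 => /eqP NE.
have pm_neq0 (z : int) : s + z%:~R != 0 by have := nonintDz z sni 0.
have levelE : level = (n%:Z - 1 - a%:Z)%:~R by rewrite /level !rmorphB /= !pmulrn.
pose P := (s + level) * (s + level + 1); pose Q := (s - level) * (s - level - 1).
have P0 : P != 0.
  rewrite /P levelE mulf_neq0 //.
  have := pm_neq0 (n%:Z - 1 - a%:Z + 1).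
  by rewrite [X in s + X]rmorphD /= addrA.
have Q0 : Q != 0.
  rewrite /Q levelE mulf_neq0 //.
    by have := pm_neq0 (- (n%:Z - 1 - a%:Z)); rewrite [X in s + X]rmorphN.
  have := pm_neq0 (- (n%:Z - 1 - a%:Z) - 1).
  by rewrite [X in s + X]rmorphB rmorphN /= addrA.
have d0 : denom (s + 1) != 0 by apply: cprod_neq0; apply: (nonintDz 1).
have d1 : denom (s - 1) != 0 by apply: cprod_neq0; apply: (nonintDz (-1)).
rewrite /primitive !mulrA; apply/eqP; rewrite eqr_div //; apply/eqP.
apply: (mulIf (mulf_neq0 P0 Q0)).
rewrite [LHS](_ : _ = N.[(s + 1) ^+ 2] * P * (numer (s + 1) * denom (s - 1) * Q)).
  by rewrite /Q numer_denom_step mulrC [N.[(s + 1) ^+ 2] * _]mulrC NE /P; ring.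
by ring.
Qed.

Definition chain_zero W y :=
  forall e, (e < a)%N -> W.[(y - a%:R + e.*2%:R + 1) ^+ 2] = 0.

Lemma primitive_chain N W y e :
  recurrence level N W -> chain_zero W y -> nonint y -> (e <= a)%N ->
  primitive N (y - a%:R + e.*2%:R) = primitive N (y - a%:R).
Proof.
move=> NW Wy yni; elim: e => [|e IH] ea; first by rewrite addr0.
rewrite -[RHS](IH (ltnW ea)); set s := y - a%:R + e.*2%:R.
have -> : y - a%:R + e.+1.*2%:R = s + 1 + 1.
  by rewrite /s doubleS -addn2 natrD; ring.
have sE : s + 1 = y + (e.*2%:Z + 1 - a%:Z)%:~R.
  by rewrite rmorphB rmorphD /= -!pmulrn /s; ring.
by rewrite (primitive_step NW (Wy e ea)) ?addrK // -/s sE; apply: nonintDz.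
Qed.

Lemma chain_zero_sign N W (s : nat) :
  recurrence level N W -> chain_zero W s%:R -> (s < n)%N -> (s + n <= a.*2)%N ->
  exists k1 k2, [/\ 0 < k1, 0 < k2 &
    N.[(s%:R + a%:R) ^+ 2] * k1 = N.[(s%:R - a%:R) ^+ 2] * k2].
Proof.
move=> NW Ws sn sna.
have sa : (s <= a)%N by lia.
suff H j : (j <= s)%N -> exists k1 k2, [/\ 0 < k1, 0 < k2 &
    N.[(a%:R - s%:R + j.*2%:R) ^+ 2] * k1 = N.[(s%:R - a%:R) ^+ 2] * k2].
  have [k1 [k2 [k1p k2p E]]] := H s (leqnn s); exists k1, k2; split=> //.
  rewrite -E -addnn natrD; congr (N.[_ ^+ 2] * _); ring.
elim: j => [|j IH] js.
  by exists 1, 1; rewrite addr0 !ltr01 -[in LHS]sqrrN opprB.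
have [k1 [k2 [k1p k2p E]]] := IH (ltnW js).
pose t : R := a%:R - s%:R + j.*2%:R + 1.
have Wt : W.[t ^+ 2] = 0.
  rewrite -(Ws (a - s + j)%N); last by lia.
  congr (W.[_ ^+ 2]); rewrite /t doubleD natrD -(addnn (a - s)) natrD natrB //; ring.
have := NW t; rewrite Wt mulr0 => /eqP; rewrite subr_eq0 => /eqP NE.
have snR : s%:R + 1 <= n%:R :> R by rewrite natr1 ler_nat.
have snaR : s%:R + n%:R <= a%:R + a%:R :> R by rewrite -!natrD ler_nat addnn.
have j0 : 0 <= j.*2%:R :> R by [].
exists (k1 * ((t + level) * (t + level + 1))), (k2 * ((t - level) * (t - level - 1))).
have p1 : 0 < t + level by rewrite /t /level; lra.
have p2 : 0 < t - level - 1 by rewrite /t /level; lra.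
have p3 : 0 < t - level by lra.
have p4 : 0 < t + level + 1 by lra.
split; first by rewrite !mulr_gt0.
  by rewrite !mulr_gt0.
have -> : a%:R - s%:R + j.+1.*2%:R = t + 1 by rewrite /t doubleS -addn2 natrD; ring.
have tE : t - 1 = a%:R - s%:R + j.*2%:R by rewrite /t; ring.
rewrite tE in NE.
rewrite [LHS](_ : _ = k1 * ((t + level) * (t + level + 1) * N.[(t + 1) ^+ 2])); last by ring.
by rewrite NE [RHS]mulrA -E; ring.
Qed.

Lemma numer_root (s : nat) : (s < n)%N -> (a.*2 < s + n)%N ->
  [/\ numer (s%:R - a%:R) = 0, numer (- s%:R + a%:R) = 0 &
      forall y, denom y = 1].
Proof.
move=> sn asn; have an : (a < n)%N by lia.
have H : numer (s%:R - a%:R) = 0.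
  apply: (@cprod_root _ _ _ (n.-1 - s)); first by lia.
  by rewrite -subnS natrB; [rewrite natrB; [rewrite -subn1 natrB; [ring|]|]|]; lia.
split=> //; last first.
  by move=> y; rewrite /denom (eqP (an : a.+1 - n == 0)%N) cprod0.
have -> : - s%:R + a%:R = - (s%:R - a%:R) :> R by ring.
rewrite /numer -(subnSK an) cprod_opp; move: H; rewrite /numer -(subnSK an) => ->.
by rewrite oppr0.
Qed.

Lemma sign_conflict (x A B p p' q q' k1 k2 : R) :
  0 < p -> 0 < p' -> 0 < q -> 0 < q' -> 0 < k1 -> 0 < k2 ->
  A * k1 = B * k2 -> x * p = A * q -> x * p' = - (B * q') -> x = 0.
Proof.
move=> p0 p'0 q0 q'0 k10 k20 E F1 F2.
have : x * (p * k1 * q' + p' * k2 * q) = 0.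
  rewrite [LHS](_ : _ = x * p * (k1 * q') + x * p' * (k2 * q)); last by ring.
  rewrite F1 F2 [LHS](_ : _ = q * q' * (A * k1 - B * k2)); last by ring.
  by rewrite E subrr mulr0.
move/eqP; rewrite mulf_eq0 => /orP[/eqP //|/eqP H].
by have : 0 < p * k1 * q' + p' * k2 * q; [rewrite addr_gt0 ?mulr_gt0|rewrite H ltxx].
Qed.

Lemma value_eq0 N W y x (z : int) :
  recurrence level N W -> chain_zero W y -> y = z%:~R -> (`|z| < n)%N ->
  x * denom (y + a%:R) = N.[(y + a%:R) ^+ 2] * numer (y + a%:R) ->
  x * denom (y - a%:R) = N.[(y - a%:R) ^+ 2] * numer (y - a%:R) ->
  x = 0.
Proof.
move=> NW Wy yz zn E1 E2; pose s := `|z|%N.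
have chain_opp (u : R) : chain_zero W u -> chain_zero W (- u).
  move=> Wu e ea; rewrite -(Wu (a - e.+1)%N); last by lia.
  rewrite -[in LHS]sqrrN; congr (W.[_ ^+ 2]).
  by rewrite doubleB natrB ?leq_double // doubleS -(addn2 e.*2) -(addnn a) !natrD; ring.
have Ws : chain_zero W s%:R.
  move: Wy; rewrite yz /s; case: (z) => k //= /chain_opp.
  by rewrite NegzE mulrNz opprK.
have [asn|sna] := ltnP a.*2 (s + n).
  have [r1 r2 d1] := numer_root zn asn.
  move: E1 E2; rewrite !d1 !mulr1 yz /s; case: (z) zn @s r1 r2 {Ws asn} => k /= kn r1 r2.
    by move=> _ ->; rewrite r1 mulr0.
  by rewrite NegzE mulrNz => -> _; rewrite r2 mulr0.
have [k1 [k2 [k1p k2p E]]] := chain_zero_sign NW Ws zn sna.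
have num_gt0 (u : nat) : (n - a <= u)%N -> 0 < numer u%:R.
  by move=> nu; apply: cprod_gt0; rewrite natr1 ltr_nat.
have den_gt0 (u : nat) : (a.+1 - n <= u)%N -> 0 < denom u%:R.
  by move=> nu; apply: cprod_gt0; rewrite natr1 ltr_nat.
have sa : (s <= a)%N by lia.
have q_gt0 : 0 < numer (s%:R + a%:R) by rewrite -natrD; apply: num_gt0; lia.
have p_gt0 : 0 < denom (s%:R + a%:R) by rewrite -natrD; apply: den_gt0; lia.
have q'_gt0 : 0 < numer (a%:R - s%:R) by rewrite -natrB //; apply: num_gt0; lia.
have p'_gt0 : 0 < denom (a%:R - s%:R) by rewrite -natrB //; apply: den_gt0; lia.
have core x' : x' * denom (s%:R + a%:R) = N.[(s%:R + a%:R) ^+ 2] * numer (s%:R + a%:R) ->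
    x' * denom (a%:R - s%:R) = - (N.[(s%:R - a%:R) ^+ 2] * numer (a%:R - s%:R)) ->
    x' = 0.
  exact: (sign_conflict p_gt0 p'_gt0 q_gt0 q'_gt0 k1p k2p E).
have opp_mul (u v w : R) : u * denom (- v) = w * numer (- v) ->
    - u * denom v = w * numer v.
  case: (numer_denom_opp v) => -[-> ->]; rewrite ?mulrN ?mulNr; last by [].
  by move=> ->; rewrite opprK.
move: core; have [yE|yE] : y = s%:R \/ y = - s%:R.
- by rewrite yz /s; case: (z) => k; [left|right; rewrite NegzE mulrNz].
- move=> core; apply: core; first by rewrite -yE.
  rewrite -yE -[LHS]opprK -mulNr (opp_mul _ _ (N.[(y - a%:R) ^+ 2])) //.
  by rewrite opprB.
- have yD : y + a%:R = a%:R - s%:R by rewrite yE; ring.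
  have yB : y - a%:R = - (s%:R + a%:R) by rewrite yE; ring.
  move=> core; apply/eqP; rewrite -oppr_eq0; apply/eqP; apply: core.
    by apply: opp_mul; rewrite -yB E2 yB sqrrN.
  by rewrite mulNr -[in LHS]yD E1 yD; congr (- (N.[_] * _)); ring.
Qed.

End Levels.

(** * Integrals with polynomial parameters *)

Section MpolySize.
Variables (R : idomainType) (l : nat).
Implicit Types p q : {mpoly R[l]}.

Lemma msizeM_leq p q (i j : nat) :
  (msize p <= i.+1)%N -> (msize q <= j.+1)%N -> (msize (p * q) <= (i + j).+1)%N.
Proof.
have [->|p0] := eqVneq p 0; first by rewrite mul0r msize0.
have [->|q0] := eqVneq q 0; first by rewrite mulr0 msize0.
by rewrite msizeM // => pi qj; lia.
Qed.

Lemma msize_prod_leq (I : Type) (r : seq I) (P : pred I) (F : I -> {mpoly R[l]})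
    (d : I -> nat) :
  (forall i, P i -> (msize (F i) <= (d i).+1)%N) ->
  (msize (\prod_(i <- r | P i) F i)%R <= (\sum_(i <- r | P i) d i).+1)%N.
Proof.
move=> Fd; apply: (big_ind2 (fun p i => (msize p <= i.+1)%N)) => //.
  by rewrite msize1.
by move=> p i q j pi qj; apply: msizeM_leq.
Qed.

Lemma msizeC_leq c : (msize (c%:MP : {mpoly R[l]}) <= 1)%N.
Proof. by rewrite msizeC; case: (c != 0). Qed.

Lemma msizeXU (i : 'I_l) : msize ('X_i : {mpoly R[l]}) = 2%N.
Proof. by rewrite msizeX mdeg1. Qed.

End MpolySize.

Section Weighted.
Variables (R : realFieldType) (l : nat).
Implicit Types (p q : {mpoly R[l]}) (P Q W : {poly {mpoly R[l]}}) (d : nat).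

(* P has degree at most d when its variable is given weight 2. *)
Definition wdeg d P := forall j, (msize P`_j <= d.+1 - j.*2)%N.

Lemma wdeg1 : wdeg 0 1.
Proof.
move=> j; rewrite coef1; case: j => [|j] /=; first by rewrite msize1.
by rewrite msize0.
Qed.

Lemma wdegMXn d P k : wdeg d P -> wdeg (d + k.*2) (P * 'X^k).
Proof.
move=> Pd j; rewrite coefMXn; case: ltnP => kj; first by rewrite msize0.
by apply: leq_trans (Pd _) _; rewrite doubleB; lia.
Qed.

Lemma wdeg_mulXsubC d P c :
  wdeg d P -> (msize c <= 3)%N -> wdeg d.+2 (P * ('X - c%:P)).
Proof.
move=> Pd c3 j; rewrite mulrBr coefB coefMX coefMC.
apply: leq_trans (msizeD_le _ _) _; rewrite geq_max msizeN.
apply/andP; split.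
  case: j => [|j] /=; first by rewrite msize0.
  by apply: leq_trans (Pd _) _; rewrite doubleS; lia.
have [->|Pj0] := eqVneq P`_j 0; first by rewrite mul0r msize0.
have := Pd j; move: (Pj0); rewrite -msize_poly_eq0 -lt0n => p0 pd.
have -> : (d.+3 - j.*2 = ((d - j.*2) + 2).+1)%N by lia.
by apply: msizeM_leq => //; move: (msize _) p0 pd => x; lia.
Qed.

Lemma wdeg_prodXsubC (I : Type) (r : seq I) (c : I -> {mpoly R[l]}) :
  (forall i, msize (c i) <= 3)%N ->
  wdeg (size r).*2 (\prod_(i <- r) ('X - (c i)%:P)).
Proof.
move=> c3; elim: r => [|i r IH]; first by rewrite big_nil; apply: wdeg1.
by rewrite big_cons mulrC; apply: wdeg_mulXsubC.
Qed.

Lemma wdeg_horner d P q :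
  wdeg d P -> (msize q <= 2)%N -> (msize P.[q ^+ 2] <= d.+1)%N.
Proof.
move=> Pd q2; rewrite horner_coef.
apply: leq_trans (msize_sum _ _ _) _; apply/bigmax_leqP => j _.
have [->|Pj0] := eqVneq P`_j 0; first by rewrite mul0r msize0.
have := Pd j; move: (Pj0); rewrite -msize_poly_eq0 -lt0n => p0 pd.
have qj e : (msize (q ^+ e) <= e.+1)%N.
  elim: e => [|e IH]; first by rewrite expr0 msize1.
  by rewrite exprS; apply: (msizeM_leq (i := 1)).
rewrite -exprM mul2n.
have pd' : (msize P`_j <= (d - j.*2).+1)%N by move: (msize _) p0 pd => x; lia.
have jd : (d - j.*2 + j.*2 = d)%N by move: (msize _) p0 pd => x; lia.
by have := msizeM_leq pd' (qj j.*2); rewrite jd.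
Qed.

Definition evalp (v : 'I_l -> R) P : {poly R} := map_poly (meval v) P.

Lemma horner_evalp v P q : P.[q].@[v] = (evalp v P).[q.@[v]].
Proof. by rewrite /evalp horner_map. Qed.

Lemma recurrence_solve_mpoly nu W d :
  (forall j : nat, 2%:R * nu + j.*2.+1%:R != 0) -> wdeg d W ->
  exists N, [/\ wdeg d N, (size N <= size W)%N &
    forall v, recurrence nu (evalp v N) (evalp v W)].
Proof.
move=> odd_nu Wd.
have /fin_all_exists [N NE] (j : 'I_(size W)) :
    exists N : {poly R}, (size N <= j.+1)%N /\ recurrence nu N 'X^j.
  have [|N] := @recurrence_solve R j.+1 nu 'X^j _ odd_nu.
    by rewrite size_polyXn.
  by exists N.
pose NN := \sum_(j < size W) W`_j *: map_poly (@mpolyC l R) (N j).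
exists NN; split.
- move=> i; rewrite coef_sum; apply: leq_trans (msize_sum _ _ _) _.
  apply/bigmax_leqP => j _; rewrite coefZ coef_map /= mulrC mul_mpolyC.
  have [ij|ji] := leqP i j.
    apply: leq_trans (msizeZ_le _ _) _.
    by apply: leq_trans (Wd j) _; lia.
  by rewrite nth_default ?scale0r ?msize0 // (leq_trans (NE j).1).
- apply: leq_trans (size_sum _ _ _) _; apply/bigmax_leqP => j _.
  apply: leq_trans (size_scale_leq _ _) _.
  apply: leq_trans (size_poly _ _) _.
  by apply: leq_trans (NE j).1 _.
- move=> v s.
  have evN : evalp v NN = \sum_(j < size W) (W`_j).@[v] *: N j.
    rewrite /evalp raddf_sum; apply: eq_bigr => j _ /=.
    rewrite map_polyZ -map_poly_comp; congr (_ *: _).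
    by apply: map_poly_id => c _ /=; rewrite mevalC.
  have evW : evalp v W = \sum_(j < size W) (W`_j).@[v] *: 'X^j.
    rewrite /evalp -{1}[W]coefK poly_def raddf_sum; apply: eq_bigr => j _ /=.
    by rewrite map_polyZ map_polyXn.
  rewrite evN evW !horner_sum mulr_sumr !mulr_sumr -sumrB; apply: eq_bigr => j _.
  rewrite !hornerZ [RHS]mulrCA -((NE j).2 s); ring.
Qed.
End Weighted.

Lemma coprimep_prodXsubC (F : fieldType) (I J : finType) (a : I -> F) (b : J -> F) :
  (forall i j, a i != b j) ->
  coprimep (\prod_i ('X - (a i)%:P)) (\prod_j ('X - (b j)%:P)).
Proof.
move=> ab; apply: (big_ind (fun p => coprimep p _)).
- exact: coprime1p.
- by move=> p q pP qP; rewrite coprimepMl pP.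
move=> i _; apply: (big_ind (fun p => coprimep _ p)).
- exact: coprimep1.
- by move=> p q pP qP; rewrite coprimepMr pP.
- by move=> j _; apply: coprimep_XsubC2; rewrite subr_eq0 eq_sym.
Qed.

Lemma coprimep_quotient (F : fieldType) (T : comNzRingType)
    (f : {rmorphism {poly F} -> T}) (P Q : {poly F}) (x y : T) :
  coprimep P Q -> x * f Q = y * f P ->
  exists g, x = g * f P /\ y = g * f Q.
Proof.
move=> /Bezout_eq1_coprimepP[[u w] /= E] xy; exists (f u * x + f w * y).
have E' := congr1 f E; rewrite rmorphD !rmorphM rmorph1 /= in E'.
split; rewrite mulrDl -!mulrA; [rewrite -xy|rewrite xy].
  rewrite -[LHS]mul1r -E'; ring.
rewrite -[LHS]mul1r -E'; ring.
Qed.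

Section Coordinates.
Variables (R : realFieldType) (l a : nat).
Implicit Types (N W : {poly {mpoly R[l]}}) (v : 'I_l -> R) (i : 'I_l).

Definition dbl i : {mpoly R[l]} := 2%:R *: 'X_i.

Lemma meval_dbl v i : (dbl i).@[v] = 2%:R * v i.
Proof. by rewrite /dbl mevalZ mevalXU. Qed.

Lemma meval_nat v (k : nat) : (k%:R : {mpoly R[l]}).@[v] = k%:R.
Proof. by rewrite -mpolyC_nat mevalC. Qed.

Lemma meval_cprod v k (s : {mpoly R[l]}) : (cprod k s).@[v] = cprod k s.@[v].
Proof. exact: (rmorph_cprod (meval v)). Qed.

Lemma msize_addC (q : {mpoly R[l]}) c : msize q = 2%N -> msize (q + c%:MP) = 2%N.
Proof.
move=> q2; apply/eqP; rewrite eqn_leq; apply/andP; split.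
  by rewrite (leq_trans (msizeD_le _ _)) // q2 geq_max (leq_trans (msizeC_leq _ _)).
have := msizeD_le (q + c%:MP) (- c%:MP); rewrite addrK q2 leq_max msizeN.
by case/orP => // /leq_trans /(_ (msizeC_leq _ _)).
Qed.

Lemma msize_dbl i c : msize (dbl i + c%:MP) = 2%N.
Proof. by apply: msize_addC; rewrite msizeZ ?msizeXU // pnatr_eq0. Qed.

Lemma msize_cprod k i c : msize (cprod k (dbl i + c%:MP)) = k.*2.-1.+1.
Proof.
rewrite /cprod; move: (k.*2.-1) => e.
have F2 (j : 'I_e) : msize (dbl i + c%:MP + (j%:R - k.-1%:R)) = 2%N.
  by rewrite -!mpolyC_nat -mpolyCB -addrA -mpolyCD msize_dbl.
have F0 (j : 'I_e) : dbl i + c%:MP + (j%:R - k.-1%:R) != 0.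
  by rewrite -msize_poly_eq0 F2.
elim: e F2 F0 => [|e IH] F2 F0; first by rewrite big_ord0 msize1.
have p0 : \prod_(j < e) (dbl i + c%:MP + (j%:R - k.-1%:R)) != 0.
  by apply/prodf_neq0 => j _; apply: (F0 (widen_ord (leqnSn e) j)).
rewrite big_ord_recr /= msizeM //; last exact: (F0 ord_max).
rewrite (F2 ord_max) IH ?addn2 // => j; first exact: (F2 (widen_ord (leqnSn e) j)).
exact: (F0 (widen_ord (leqnSn e) j)).
Qed.

Lemma nonint_small (r : R) : 0 < r < 2%:R^-1 -> nonint (2%:R * r).
Proof.
move=> /andP[r0 r1] z; apply/eqP => E.
have : 0 < z%:~R :> R by rewrite -E; lra.
have : z%:~R < 1 :> R by rewrite -E; lra.
by rewrite -[1]/(1%:~R) -[0]/(0%:~R) ltr_int ltr0z; lia.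
Qed.

Section Coordinate.
Variables (n d : nat) (N W : {poly {mpoly R[l]}}) (i : 'I_l).
Hypothesis N_wdeg : wdeg d N.
Hypothesis NW : forall v, recurrence (level R n a) (evalp v N) (evalp v W).
Hypothesis W0 : forall v, chain_zero a (evalp v W) (2%:R * v i).

Let up := N.[(dbl i + a%:R) ^+ 2] * cprod (n - a) (dbl i + a%:R).
Let down := N.[(dbl i - a%:R) ^+ 2] * cprod (n - a) (dbl i - a%:R).

Lemma up_down :
  up * cprod (a.+1 - n) (dbl i - a%:R) = down * cprod (a.+1 - n) (dbl i + a%:R).
Proof.
apply/eqP; rewrite -subr_eq0; apply/eqP; apply: mpoly_eq0_small => v v_small.
apply/eqP; rewrite mevalB subr_eq0 /up /down !mevalM !meval_cprod !horner_evalp.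
rewrite !rmorphXn /= mevalD mevalB meval_dbl meval_nat.
have yni := nonint_small (v_small i).
have := primitive_chain (NW v) (W0 v) yni (leqnn a).
have -> : 2%:R * v i - a%:R + a.*2%:R = 2%:R * v i + a%:R.
  by rewrite -addnn natrD; ring.
rewrite /primitive !mulrA => /eqP; rewrite eqr_div //.
  exact: (cprod_neq0 _ (nonintDz a yni)).
by have := cprod_neq0 (a.+1 - n) (nonintDz (- a%:Z) yni); rewrite rmorphN.
Qed.

Lemma msize_up : (msize up <= d + (n - a).*2.-1.+1)%N.
Proof.
rewrite /up addnS; apply: msizeM_leq.
  apply: wdeg_horner => //.
  by rewrite -mpolyC_nat msize_dbl.
by rewrite -mpolyC_nat msize_cprod.
Qed.

Lemma coordinate_poly :
  (0 < n)%N -> (a.*2 <= d)%N -> exists f : {mpoly R[l]},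
  [/\ (msize f + a.*2 <= d + n.*2)%N,
      forall v, nonint (2%:R * v i) ->
        f.@[v] = primitive n a (evalp v N) (2%:R * v i + a%:R) &
      forall v (z : int), 2%:R * v i = z%:~R -> (`|z| < n)%N -> f.@[v] = 0].
Proof.
move=> n0 ad; pose k := (a.+1 - n)%N.
pose P := cprod k ('X + a%:R : {poly R}); pose Q := cprod k ('X - a%:R : {poly R}).
have PQ : coprimep P Q.
  have PE (c : R) : cprod k ('X + c%:P) =
      \prod_(j < k.*2.-1) ('X - (- (c + (j%:R - k.-1%:R)))%:P).
    by apply: eq_bigr => j _; rewrite polyCN opprK !polyCD polyCN !polyC_natr !addrA.
  rewrite /P /Q -!polyC_natr -polyCN !PE; apply: coprimep_prodXsubC => j1 j2.
  rewrite eqr_opp; apply/eqP => E.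
  have : ((a + a + j1)%:R == j2%:R :> R).
    by rewrite !natrD; apply/eqP; move: E; lra.
  rewrite eqr_nat; have := ltn_ord j2; rewrite /k; lia.
have [f [fP fQ]] : exists f, up = f * cprod k (dbl i + a%:R) /\
    down = f * cprod k (dbl i - a%:R).
  have EP : horner_alg (dbl i) P = cprod k (dbl i + a%:R).
    by rewrite (rmorph_cprod (horner_alg (dbl i))) rmorphD rmorph_nat /= horner_algX.
  have EQ : horner_alg (dbl i) Q = cprod k (dbl i - a%:R).
    by rewrite (rmorph_cprod (horner_alg (dbl i))) rmorphB rmorph_nat /= horner_algX.
  have := @coprimep_quotient _ _ (horner_alg (dbl i)) P Q up down PQ.
  by rewrite /= EP EQ; apply; apply: up_down.
have upE v : up.@[v] =
    (evalp v N).[(2%:R * v i + a%:R) ^+ 2] * numer n a (2%:R * v i + a%:R).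
  by rewrite /up mevalM meval_cprod horner_evalp rmorphXn /= mevalD meval_dbl meval_nat.
have downE v : down.@[v] =
    (evalp v N).[(2%:R * v i - a%:R) ^+ 2] * numer n a (2%:R * v i - a%:R).
  by rewrite /down mevalM meval_cprod horner_evalp rmorphXn /= mevalB meval_dbl meval_nat.
have fup v : f.@[v] * denom n a (2%:R * v i + a%:R) = up.@[v].
  by rewrite fP mevalM meval_cprod mevalD meval_dbl meval_nat.
have fdown v : f.@[v] * denom n a (2%:R * v i - a%:R) = down.@[v].
  by rewrite fQ mevalM meval_cprod mevalB meval_dbl meval_nat.
exists f; split.
- have [->|f0] := eqVneq f 0; first by rewrite msize0; lia.
  have := msize_up; rewrite fP.
  have c0 : cprod k (dbl i + a%:R) != 0.
    by rewrite -msize_poly_eq0 -mpolyC_nat msize_cprod.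
  rewrite msizeM // -[in X in (X <= _)%N -> _]mpolyC_nat msize_cprod /k.
  move: f0; rewrite -msize_poly_eq0; move: (msize f) => x; lia.
- move=> v yni; rewrite /primitive mulrA -upE -fup mulfK //.
  exact: (cprod_neq0 _ (nonintDz a yni)).
- move=> v z yz zn.
  by apply: (value_eq0 (NW v) (W0 v) yz zn); rewrite ?fup ?fdown ?upE ?downE.
Qed.

Lemma coordinate_poly_pole :
  n = 0%N -> (a.*2 <= d)%N -> exists f : {mpoly R[l]},
  [/\ (msize f + a.*2 <= d.+1)%N &
      forall v, nonint (2%:R * v i) ->
        f.@[v] = 2%:R * v i * primitive n a (evalp v N) (2%:R * v i + a%:R)].
Proof.
move=> n0 ad.
pose P : {poly R} := \prod_(j < a.*2) ('X - (- (j.+1%:R))%:P).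
pose Q : {poly R} := \prod_(j < a.*2) ('X - (j.+1%:R)%:P).
have PQ : coprimep P Q.
  apply: coprimep_prodXsubC => j1 j2; rewrite -subr_eq0 -opprD oppr_eq0 -natrD.
  by rewrite pnatr_eq0.
have cP (T : comNzRingType) (s : T) :
    cprod (a.+1 - n) (s + a%:R) = s * \prod_(j < a.*2) (s + j.+1%:R).
  rewrite n0 subn0 /cprod doubleS /= big_ord_recl /=; congr (_ * _); first by ring.
  by apply: eq_bigr => j _; rewrite /bump /=; ring.
have cQ (T : comNzRingType) (s : T) :
    cprod (a.+1 - n) (s - a%:R) = s * \prod_(j < a.*2) (s - j.+1%:R).
  rewrite n0 subn0 /cprod doubleS /= big_ord_recr /= mulrC; congr (_ * _).
    by rewrite -addnn natrD; ring.
  rewrite (reindex_inj rev_ord_inj) /=; apply: eq_bigr => j _.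
  have E : a.*2%:R = a%:R + a%:R :> T by rewrite -natrD addnn.
  by rewrite natrB ?ltn_ord // E; ring.
have EP : horner_alg (dbl i) P = \prod_(j < a.*2) (dbl i + j.+1%:R).
  rewrite /P rmorph_prod; apply: eq_bigr => j _.
  by rewrite rmorphB /= horner_algX polyCN rmorphN opprK polyC_natr rmorph_nat.
have EQ : horner_alg (dbl i) Q = \prod_(j < a.*2) (dbl i - j.+1%:R).
  rewrite /Q rmorph_prod; apply: eq_bigr => j _.
  by rewrite rmorphB /= horner_algX polyC_natr rmorph_nat.
have dbl0 : dbl i != 0 by rewrite -msize_poly_eq0 -[dbl i]addr0 -mpolyC0 msize_dbl.
have [f [fP _]] : exists f, up = f * horner_alg (dbl i) P /\
    down = f * horner_alg (dbl i) Q.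
  apply: coprimep_quotient PQ _; apply: (mulfI dbl0).
  by rewrite /= EP EQ mulrCA -cQ up_down cP mulrCA.
exists f; split.
- have [->|f0] := eqVneq f 0; first by rewrite msize0 add0n ltnW.
  have := msize_up; rewrite fP EP.
  have F2 (j : nat) : msize (dbl i + j%:R) = 2%N by rewrite -mpolyC_nat msize_dbl.
  have F0 (j : nat) : dbl i + j%:R != 0 by rewrite -msize_poly_eq0 F2.
  have pE e : msize (\prod_(j < e) (dbl i + j.+1%:R)) = e.+1 /\
      \prod_(j < e) (dbl i + j.+1%:R) != 0.
    have p0 : \prod_(j < e) (dbl i + j.+1%:R) != 0 by apply/prodf_neq0 => j _.
    split=> //; elim: e {p0} => [|e IH]; first by rewrite big_ord0 msize1.
    have p0 : \prod_(j < e) (dbl i + j.+1%:R) != 0 by apply/prodf_neq0 => j _.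
    by rewrite big_ord_recr /= msizeM // F2 IH addn2.
  have [p1 p2] := pE a.*2.
  rewrite msizeM // p1 n0; move: f0; rewrite -msize_poly_eq0.
  move: (msize f) => x; lia.
- move=> v yni; rewrite /primitive.
  have upE : up.@[v] =
      (evalp v N).[(2%:R * v i + a%:R) ^+ 2] * numer n a (2%:R * v i + a%:R).
    by rewrite /up mevalM meval_cprod horner_evalp rmorphXn /= mevalD meval_dbl meval_nat.
  have den0 : denom n a (2%:R * v i + a%:R) != 0 by exact: (cprod_neq0 _ (nonintDz a yni)).
  rewrite [X in _ * X]mulrA -upE fP mevalM.
  have -> : (horner_alg (dbl i) P).@[v] = denom n a (2%:R * v i + a%:R) / (2%:R * v i).
    rewrite /denom cP EP mulrAC mulfV ?mul1r; last exact: (yni 0).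
    rewrite rmorph_prod; apply: eq_bigr => j _ /=.
    by rewrite mevalD meval_dbl meval_nat.
  have v0 : v i != 0 by apply: contra_neq (yni 0) => ->; rewrite mulr0.
  by field; rewrite ?den0 ?v0.
Qed.

End Coordinate.
End Coordinates.

Section PrimitiveSymmetry.
Variables (R : realFieldType) (n a : nat) (N W : {poly R}).
Implicit Types y : R.
Hypothesis NW : recurrence (level R n a) N W.

Lemma primitive_same y y' (s : int) :
  chain_zero a W y -> chain_zero a W y' -> nonint y -> nonint y' ->
  - a%:Z <= s <= a%:Z -> y = y' + 2%:R * s%:~R ->
  primitive n a N (y + a%:R) = primitive n a N (y' + a%:R).
Proof.
wlog s0 : y y' s / 0 <= s => [H|].
  move=> Wy Wy' yni y'ni sa yE; have [s0|s0] := leP 0 s; first exact: (H _ _ s).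
  apply/esym; apply: (H _ _ (- s)) => //; [by lia|by lia|].
  by rewrite yE rmorphN; ring.
move=> Wy _ yni _ sa yE.
have sE : s%:~R = `|s|%N%:R :> R by rewrite pmulrn gez0_abs.
have {1}-> : y + a%:R = y - a%:R + a.*2%:R by rewrite -addnn natrD; ring.
have -> : y' + a%:R = y - a%:R + (a - `|s|)%N.*2%:R.
  by rewrite -addnn natrD natrB ?yE ?sE; [ring|lia].
by rewrite !(primitive_chain NW) //; lia.
Qed.

Lemma primitive_opposite y y' (s : int) :
  chain_zero a W y -> chain_zero a W y' -> nonint y -> nonint y' ->
  - a%:Z <= s <= a%:Z -> y + y' = 2%:R * s%:~R ->
  primitive n a N (y + a%:R) = - primitive n a N (y' + a%:R).
Proof.
move=> Wy Wy' yni y'ni sa yE; rewrite -primitive_opp.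
have chain z e : chain_zero a W z -> nonint z -> (e <= a)%N ->
    primitive n a N (z - a%:R + e.*2%:R) = primitive n a N (z + a%:R).
  move=> Wz zni ea; rewrite (primitive_chain NW) //.
  have -> : z + a%:R = z - a%:R + a.*2%:R by rewrite -addnn natrD; ring.
  by rewrite (primitive_chain NW).
have [s0|s0] := leP 0 s.
  have sE : s%:~R = `|s|%N%:R :> R by rewrite pmulrn gez0_abs.
  rewrite primitive_opp -(chain y' 0%N) // -primitive_opp -(chain y (a - `|s|)%N) //; last by lia.
  congr (primitive _ _ _ _).
  have -> : y = 2%:R * s%:~R - y' by rewrite -yE; ring.
  by rewrite sE double0 -addnn natrD natrB; [ring|lia].
have sE : s%:~R = - (`|s|%N%:R) :> R.
  by rewrite pmulrn ltz0_abs // rmorphN opprK.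
rewrite -(chain y `|s|%N) //; last by lia.
congr (primitive _ _ _ _).
have -> : y = 2%:R * s%:~R - y' by rewrite -yE; ring.
by rewrite sE -addnn natrD; ring.
Qed.

End PrimitiveSymmetry.

Lemma cprodS (T : comNzRingType) k (s : T) :
  cprod k.+2 s = (s ^+ 2 - k.+1%:R ^+ 2) * cprod k.+1 s.
Proof.
rewrite /cprod doubleS /= big_ord_recl big_ord_recr /=.
rewrite [X in _ * (X * _)](_ : _ = \prod_(i < k.*2.+1) (s + (i%:R - k%:R))).
  have E : k.*2.+2%:R = k.+1%:R + k.+1%:R :> T by rewrite -natrD addnS addSn addnn.
  by rewrite /bump /= add1n E; ring.
apply: eq_bigr => i _; rewrite /bump /= add1n.
by rewrite -(natr1 i) -(natr1 k); ring.
Qed.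

Lemma primitive_shift (R : realFieldType) n a (N : {poly R}) s :
  nonint s ->
  primitive n a (('X - ((level R n a + 1) ^+ 2)%:P) * N) s = primitive n.+1 a N s.
Proof.
move=> sni; rewrite /primitive hornerM hornerXsubC /numer /denom /level.
rewrite [RHS]mulrC mulrAC -[LHS]mulrC mulrC; congr (_ * _).
have s0 : s != 0 := sni 0.
have [an|na] := ltnP n a.
  have [j ->] : exists j, a = (n + j.+1)%N by exists (a - n.+1)%N; lia.
  have e1 : (n - (n + j.+1) = 0)%N by lia.
  have e2 : (n.+1 - (n + j.+1) = 0)%N by lia.
  have e3 : ((n + j.+1).+1 - n = j.+2)%N by lia.
  have e4 : ((n + j.+1).+1 - n.+1 = j.+1)%N by lia.
  rewrite e1 e2 e3 e4.
  have c2 := cprod_neq0 j.+2 sni; have c1 := cprod_neq0 j.+1 sni.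
  rewrite cprodS in c2 *; rewrite !cprod0 natrD.
  have -> : n%:R - 1 - (n%:R + j.+1%:R) + 1 = - (j.+1%:R) :> R by ring.
  have d0 : s ^+ 2 - j.+1%:R ^+ 2 != 0 by apply: contra_neq c2 => ->; rewrite mul0r.
  by move: (j.+1%:R : R) d0 => k d0; field; rewrite c1 d0.
have [->|an] := eqVneq n a.
  rewrite !subnn subSnn.
  rewrite !cprod0 /cprod /= big_ord1 /=.
  rewrite (_ : (a%:R - 1 - a%:R + 1 : R) = 0); last by ring.
  by field.
have [j ->] : exists j, n = (a + j.+1)%N by exists (n - a.+1)%N; lia.
have e1 : (a + j.+1 - a = j.+1)%N by lia.
have e2 : ((a + j.+1).+1 - a = j.+2)%N by lia.
have e3 : (a.+1 - (a + j.+1) = 0)%N by lia.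
have e4 : (a.+1 - (a + j.+1).+1 = 0)%N by lia.
rewrite e1 e2 e3 e4.
rewrite cprodS !cprod0 natrD.
by rewrite (_ : (a%:R + j.+1%:R - 1 - a%:R + 1 : R) = j.+1%:R); [field|ring].
Qed.

Section RecurrenceLinear.
Variables (R : realFieldType) (nu : R).
Implicit Types N W : {poly R}.

Lemma recurrenceD N N' W W' :
  recurrence nu N W -> recurrence nu N' W' -> recurrence nu (N + N') (W + W').
Proof. by move=> NW NW' s; rewrite !hornerD [RHS]mulrDr -NW -NW'; ring. Qed.

Lemma recurrenceZ c N W : recurrence nu N W -> recurrence nu (c *: N) (c *: W).
Proof. by move=> NW s; rewrite !hornerZ [RHS]mulrCA -NW; ring. Qed.

Lemma recurrence_sum (I : Type) (r : seq I) (F G : I -> {poly R}) :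
  (forall i, recurrence nu (F i) (G i)) ->
  recurrence nu (\sum_(i <- r) F i) (\sum_(i <- r) G i).
Proof.
move=> FG; apply: (big_ind2 (recurrence nu)) => // [s|? ? ? ?].
  by rewrite !horner0; ring.
exact: recurrenceD.
Qed.

Lemma recurrence0 W : recurrence nu 0 W -> W = 0.
Proof.
move=> W0; apply: (@poly_eq0_on_seq _ W (fun k => k.+1%:R ^+ 2)).
  move=> i j /eqP; rewrite eqrXn2 // ?ler0n // eqr_nat => /eqP []; exact.
move=> k; have := W0 k.+1%:R; rewrite !horner0 !mulr0 subr0 => /esym /eqP.
by rewrite mulf_eq0 pnatr_eq0 /= => /eqP.
Qed.

End RecurrenceLinear.

Section Families.
Variables (R : realFieldType) (l a : nat).
Implicit Types (v : 'I_l -> R) (N W : {poly {mpoly R[l]}}).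

Definition chain_root (x : 'I_l * 'I_a) : {mpoly R[l]} :=
  (dbl R x.1 - a%:R + (x.2).*2%:R + 1) ^+ 2.

Definition chain_poly : {poly {mpoly R[l]}} := \prod_x ('X - (chain_root x)%:P).

Lemma chain_poly_monic : chain_poly \is monic.
Proof. by apply: monic_prod => x _; apply: monicXsubC. Qed.

Lemma card_chain : size (index_enum ('I_l * 'I_a)%type) = (l * a)%N.
Proof.
have <- : #|{: 'I_l * 'I_a}| = (l * a)%N by rewrite card_prod !card_ord.
by rewrite -sum1_size -sum1_card; apply: eq_bigl.
Qed.

Lemma size_chain_poly k : size (chain_poly * 'X^k) = (l * a + k).+1.
Proof.
rewrite size_monicM ?chain_poly_monic ?monic_neq0 ?monicXn // size_polyXn.
by rewrite /chain_poly size_prod_XsubC card_chain addnS.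
Qed.

Lemma wdeg_chain_poly k : wdeg ((l * a).*2 + k.*2) (chain_poly * 'X^k).
Proof.
apply: wdegMXn; rewrite -card_chain; apply: wdeg_prodXsubC => x.
have E : chain_root x = (dbl R x.1 + ((x.2).*2%:R + 1 - a%:R)%:MP) ^+ 2.
  rewrite /chain_root mpolyCB mpolyCD !mpolyC_nat mpolyC1; congr (_ ^+ 2); ring.
by rewrite E expr2; apply: (msizeM_leq (i := 1) (j := 1)); rewrite msize_dbl.
Qed.

Lemma chain_poly_zero v k i : chain_zero a (evalp v (chain_poly * 'X^k)) (2%:R * v i).
Proof.
move=> e ea.
have <- : (chain_root (i, Ordinal ea)).@[v] = (2%:R * v i - a%:R + e.*2%:R + 1) ^+ 2.
  rewrite /chain_root rmorphXn /= !mevalD mevalN meval_dbl !meval_nat.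
  by rewrite meval1.
rewrite -horner_evalp hornerM /chain_poly horner_prod (bigD1 (i, Ordinal ea)) //=.
set r := chain_root _; set q := \prod_(_ | _) _.
by rewrite hornerXsubC (subrr r) (mul0r q) mul0r meval0.
Qed.

Lemma evalp_chain_poly v k :
  evalp v (chain_poly * 'X^k) = evalp v chain_poly * 'X^k.
Proof. by rewrite /evalp rmorphM /= map_polyXn. Qed.

Lemma evalp_chain_neq0 v : evalp v chain_poly != 0.
Proof. by rewrite monic_neq0 // /evalp monic_map // chain_poly_monic. Qed.

Lemma chain_family n k : exists N,
  [/\ wdeg ((l * a).*2 + k.*2) N, (size N <= (l * a + k).+1)%N &
    forall v, recurrence (level R n a) (evalp v N) (evalp v (chain_poly * 'X^k))].
Proof.
rewrite -size_chain_poly; apply: recurrence_solve_mpoly.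
  exact: level_odd.
exact: wdeg_chain_poly.
Qed.

(* The shifts 2 v j - a + 2 e, e <= a, of the coordinates of this point are
   consecutive terms of a single arithmetic progression. *)
Definition generic_point (j : 'I_l) : R := (a.+1 * j.+1)%:R + 6%:R^-1.

Lemma generic_nonint j : nonint (2%:R * generic_point j).
Proof.
move=> z; apply/eqP => E.
have : ((6%:Z * (a.+1 * j.+1)%N%:Z + 1)%:~R : R) = (3%:Z * z)%:~R.
  rewrite rmorphD !rmorphM /= -E /generic_point -!pmulrn.
  have -> : (3%:R : R) * (2%:R * ((a.+1 * j.+1)%:R + 6%:R^-1)) =
    6%:R * (a.+1 * j.+1)%:R + 1 by field.
  by [].
by move/eqP; rewrite eqr_int => /eqP; lia.
Qed.

Lemma generic_vanish (N : {poly R}) :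
  (size N <= a.+1 * l)%N ->
  (forall j e, (e <= a)%N -> N.[(2%:R * generic_point j - a%:R + e.*2%:R) ^+ 2] = 0) ->
  N = 0.
Proof.
move=> Nl N0; apply/eqP; apply: contraT => Nn0.
pose r (k : nat) : R := (k.*2%:R + 3%:R^-1 - a%:R).
suff : (size [seq r k ^+ 2 | k <- iota a.+1 (a.+1 * l)] < size N)%N.
  by rewrite size_map size_iota ltnNge Nl.
apply: max_poly_roots => //.
  apply/allP => _ /mapP[k + ->]; rewrite mem_iota => /andP[k1 k2].
  have jl : (k %/ a.+1 - 1 < l)%N.
    have : (k %/ a.+1 < l.+1)%N by rewrite ltn_divLR // mulnC mulnS.
    have : (0 < k %/ a.+1)%N by rewrite divn_gt0.
    lia.
  have ea : (k %% a.+1 <= a)%N by rewrite -ltnS ltn_mod.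
  apply/rootP; rewrite -(N0 (Ordinal jl) _ ea); congr (N.[_ ^+ 2]).
  rewrite /r /generic_point -[nat_of_ord (Ordinal jl)]/(k %/ a.+1 - 1)%N.
  have -> : (k %/ a.+1 - 1).+1 = (k %/ a.+1)%N by have : (0 < k %/ a.+1)%N by [rewrite divn_gt0]; lia.
  have kE : (k%:R : R) = (a.+1 * (k %/ a.+1))%:R + (k %% a.+1)%:R.
    by rewrite -natrD mulnC -divn_eq.
  move: (a.+1 * _)%N (k %% a.+1)%N kE => b e kE.
  by rewrite -!addnn !natrD kE; field.
rewrite map_inj_in_uniq ?iota_uniq // => i j.
rewrite !mem_iota => /andP[i1 _] /andP[j1 _] /eqP.
have r0 k : (a.+1 <= k)%N -> 0 <= r k.
  rewrite -(ler_nat R) -(natr1 a) /r => ak; rewrite -addnn natrD.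
  have a0 : 0 <= a%:R :> R by [].
  have : 0 < 3%:R^-1 :> R by rewrite invr_gt0.
  by lra.
rewrite eqrXn2 ?r0 // => /eqP /addIr /addIr /eqP.
by rewrite eqr_nat => /eqP /double_inj.
Qed.

End Families.

(** * Derivations of the cone *)

Section Adapted.
Variables (R : realType) (l p m a : nat).
Implicit Types (v : 'I_l -> R) (f : 'I_l -> {mpoly R[l]}) (N : {poly {mpoly R[l]}}).

Definition solves n k N :=
  forall v, recurrence (level R n a) (evalp v N) (evalp v (chain_poly R l a * 'X^k)).

Definition adapted n k d (Q : {mpoly R[l]}) N f :=
  [/\ solves n k N,
      forall i, (msize (f i) <= d.+1)%N,
      forall v i, nonint (2%:R * v i) ->
        (f i).@[v] = Q.@[v] * primitive n a (evalp v N) (2%:R * v i + a%:R) &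
      forall v i (z : int), 2%:R * v i = z%:~R ->
        (if (i < p)%N then 1 - m%:Z else - m%:Z) <= z <= m%:Z -> (f i).@[v] = 0].

Lemma sum_delta f i : \sum_t (delta_mx 0 i : 'rV[R]_l) 0 t *: f t = f i.
Proof.
rewrite (bigD1 i) //= mxE !eqxx scale1r big1 ?addr0 // => t ti.
by rewrite mxE (negPf ti) scale0r.
Qed.

Lemma adapted_pair n k d Q N f i j (e : bool) (s : int) :
  adapted n k d Q N f -> i != j -> - a%:Z <= s <= a%:Z ->
  exists g, f i + (-1) ^+ e * f j = ('X_i - (s%:~R%:MP - (-1) ^+ e * 'X_j)) * g.
Proof.
move=> [NW _ fE _] ij sa; apply: mpoly_dvd_small => v v_small.
set v' := fun t => _.
have vj : v' j = v j by rewrite /v' eq_sym (negPf ij).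
have vi : v' i = s%:~R - (-1) ^+ e * v j.
  rewrite /v' eqxx mevalB mevalC mevalM mevalXU rmorphXn /= mevalN meval1.
  by [].
clearbody v'.
have yjni : nonint (2%:R * v' j) by rewrite vj; apply: nonint_small.
have yini : nonint (2%:R * v' i).
  have -> : 2%:R * v' i = - ((-1) ^+ e * (2%:R * v' j)) + (s + s)%:~R.
    by rewrite vi vj rmorphD /=; ring.
  apply/nonintDz/nonintN; case: e {vi}; rewrite ?expr0 ?expr1 ?mul1r ?mulN1r //.
  exact: nonintN.
rewrite mevalD mevalM rmorphXn /= mevalN meval1 !fE // [X in _ + X]mulrCA -mulrDr.
suff -> : primitive n a (evalp v' N) (2%:R * v' i + a%:R) =
    - ((-1) ^+ e * primitive n a (evalp v' N) (2%:R * v' j + a%:R)).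
  by rewrite addNr mulr0.
have chain t := chain_poly_zero (a := a) v' k t.
case: e vi => vi; rewrite ?expr0 ?expr1 ?mul1r ?mulN1r ?opprK.
  apply: (primitive_same (NW v') (chain i) (chain j) yini yjni sa).
  by rewrite vi vj expr1; ring.
apply: (primitive_opposite (NW v') (chain i) (chain j) yini yjni sa).
by rewrite vi vj expr0; ring.
Qed.

Lemma adapted_row_log n k d Q N f al :
  adapted n k d Q N f -> cone (@arrC R l p m a) al -> row_log (homogenize_row d f) al.
Proof.
move=> fA; have [_ f_size _ f0] := fA.
have neq (i j : 'I_l) : (i < j)%N -> i != j by move=> ij; rewrite neq_ltn ij.
have diag (i : 'I_l) (s : int) :
    (if (i < p)%N then 1 - m%:Z else - m%:Z) <= s <= m%:Z ->
    row_log (homogenize_row d f) (row_mx (2%:R *: delta_mx 0 i) (const_mx (- s%:~R))).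
  move=> sm; apply: homogenize_row_log => //.
    by apply/eqP => /rowP/(_ i); rewrite !mxE !eqxx mulr1 => /eqP; rewrite pnatr_eq0.
  rewrite /affine_form.
  have -> : \sum_t (2%:R *: delta_mx 0 i : 'rV[R]_l) 0 t *: 'X_t = 2%:R *: 'X_i.
    rewrite -[in RHS](sum_delta (fun t => 'X_t) i) scaler_sumr.
    by apply: eq_bigr => t _; rewrite mxE scalerA.
  have -> : \sum_t (2%:R *: delta_mx 0 i : 'rV[R]_l) 0 t *: f t = 2%:R *: f i.
    rewrite -[in RHS](sum_delta f i) scaler_sumr.
    by apply: eq_bigr => t _; rewrite mxE scalerA.
  have [|g ->] := @mpoly_dvd_small R l i (s%:~R / 2%:R)%:MP (f i).
    move=> v _; apply: (f0 _ _ s) => //; rewrite eqxx mevalC mulrCA mulfV ?mulr1 //.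
    by rewrite pnatr_eq0.
  exists g; rewrite scalerAl scalerBr; congr ((_ - _) * _).
  rewrite -mul_mpolyC -mpolyCM; congr (_%:MP).
  by rewrite mulrCA mulfV ?mulr1 // pnatr_eq0.
case=> [v s [i j t ij ta|i j t ij ta|i t ip tm|i t ip tm]|].
- apply: homogenize_row_log => //.
    apply/eqP => /rowP/(_ i); rewrite !mxE !eqxx (negPf (neq _ _ ij)) addr0.
    by move/eqP; rewrite oner_eq0.
  have lin (g : 'I_l -> {mpoly R[l]}) :
      \sum_u (delta_mx 0 i + delta_mx 0 j : 'rV[R]_l) 0 u *: g u = g i + g j.
    rewrite -(sum_delta g i) -(sum_delta g j) -big_split /=.
    by apply: eq_bigr => u _; rewrite mxE scalerDl.
  have [g] := adapted_pair false fA (neq _ _ ij) ta.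
  rewrite expr0 !mul1r => E; exists g; rewrite lin E /affine_form lin; congr (_ * _).
  by ring.
- apply: homogenize_row_log => //.
    apply/eqP => /rowP/(_ i); rewrite !mxE !eqxx (negPf (neq _ _ ij)) subr0.
    by move/eqP; rewrite oner_eq0.
  have lin (g : 'I_l -> {mpoly R[l]}) :
      \sum_u (delta_mx 0 i - delta_mx 0 j : 'rV[R]_l) 0 u *: g u = g i - g j.
    rewrite -(sum_delta g i) -(sum_delta g j) -sumrB /=.
    by apply: eq_bigr => u _; rewrite !mxE scalerBl.
  have [g] := adapted_pair true fA (neq _ _ ij) ta.
  rewrite expr1 !mulN1r => E; exists g; rewrite lin E /affine_form lin; congr (_ * _).
  by ring.
- by apply: diag; rewrite ip.
- by apply: diag; rewrite ltnNge ip.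
- exists 0; rewrite mulr0 big_split_ord /= big_ord1 big1 ?add0r => [|i _].
    by rewrite mxE split_rshift mul0r.
  by rewrite row_mxEl !mxE mpolyC0 mulr0.
Qed.

End Adapted.

Lemma sum_leq_ord (l p : nat) : (p <= l)%N -> (\sum_(j < l) (p <= j) = l - p)%N.
Proof.
elim: l p => [|l IH] p pl; first by rewrite big_ord0; lia.
rewrite big_ord_recr /=; have [pl'|lp] := leqP p l; first by rewrite IH //; lia.
rewrite big1 => [|j _]; first by lia.
by have := ltn_ord j; case: leqP => //; lia.
Qed.

Section Basis.
Variables (R : realType) (l p m a : nat).
Hypotheses (l_ge1 : (1 <= l)%N) (p_le_l : (p <= l)%N).
Implicit Types (v : 'I_l -> R) (N : {poly {mpoly R[l]}}).

Let c := (2 * m + 2 * a * l - 2 * a)%N.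

Let cE : (c + a.*2 = m.*2 + (l * a).*2)%N.
Proof. by clear p_le_l; rewrite /c -!mul2n; nia. Qed.

Lemma theta_family k : exists N f,
  adapted p m a m.+1 k (c + (2 * k + 1)) (1 : {mpoly R[l]}) N f /\
  (size N <= (l * a + k).+1)%N.
Proof.
clear p_le_l.
have [N [Nd Ns NW]] := chain_family R l a m.+1 k.
have ad : (a.*2 <= (l * a).*2 + k.*2)%N by nia.
have /fin_all_exists [f fE] i :=
  coordinate_poly Nd NW (fun v => chain_poly_zero v k i) (ltn0Sn m) ad.
exists N, f; split=> //; split=> //.
- move=> i; have [fi _ _] := fE i; move: (msize _) fi => x; lia.
- by move=> v i yni; rewrite meval1 mul1r; have [_ -> ] := fE i.
- move=> v i z yz zm; have [_ _ H] := fE i; apply: (H _ z) => //.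
  by case: ltnP zm => _; lia.
Qed.

Definition edge_factor (j : 'I_l) : {mpoly R[l]} :=
  (dbl R j - m%:R) * (if (p <= j)%N then dbl R j + m%:R else 1).

Definition edge_prod : {mpoly R[l]} := \prod_j edge_factor j.

Lemma edge_prod_neq0 v : (forall j, nonint (2%:R * v j)) -> edge_prod.@[v] != 0.
Proof.
move=> yni; rewrite /edge_prod rmorph_prod; apply/prodf_neq0 => j _ /=.
rewrite mevalM mevalB meval_dbl meval_nat mulf_neq0 //.
  by have := yni j m; rewrite subr_eq0.
case: ifP => _; last by rewrite meval1 oner_eq0.
rewrite mevalD meval_dbl meval_nat -[m%:R]opprK subr_eq0.
by have := yni j (- m%:Z); rewrite rmorphN.
Qed.

Lemma phi_coordinate N i :
  wdeg (l * a).*2 N -> solves a m 0 N -> exists w : {mpoly R[l]},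
  [/\ (msize w <= c.+1)%N,
      forall v, nonint (2%:R * v i) -> w.@[v] =
        (2%:R * v i - m%:R) * primitive m a (evalp v N) (2%:R * v i + a%:R) &
      forall v (z : int), 2%:R * v i = z%:~R -> 1 - m%:Z <= z <= m%:Z -> w.@[v] = 0].
Proof.
move=> Nd NW; have W0 v := chain_poly_zero (a := a) v 0 i.
have ad : (a.*2 <= (l * a).*2)%N by nia.
have [m0|m_gt0] := posnP m.
  have [w [ws wE]] := coordinate_poly_pole Nd NW W0 m0 ad.
  exists w; split.
  - by move: (msize _) ws => x; lia.
  - by move=> v yni; rewrite wE // m0 subr0.
  - by move=> v z _; rewrite m0; lia.
have [f [fs fE f0]] := coordinate_poly Nd NW W0 m_gt0 ad.
have dblE v : (dbl R i - m%:R).@[v] = 2%:R * v i - m%:R.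
  by rewrite mevalB meval_dbl meval_nat.
exists ((dbl R i - m%:R) * f); split.
- have c_gt0 : (0 < c)%N by lia.
  rewrite -(prednK c_gt0); apply: (msizeM_leq (i := 1)).
    by rewrite -mpolyC_nat -mpolyCN msize_dbl.
  by rewrite prednK //; move: (msize _) fs => x; lia.
- by move=> v yni; rewrite mevalM dblE fE.
- move=> v z yz zm; rewrite mevalM dblE.
  have [zE|zm'] := eqVneq z m%:Z; first by rewrite yz zE -pmulrn subrr mul0r.
  by rewrite (f0 v z) ?mulr0 //; lia.
Qed.

Lemma phi_family : exists N f,
  adapted p m a m 0 (c + 2 * l - p - 1) edge_prod N f /\
  (size N <= (l * a).+1)%N.
Proof.
have [N [Nd Ns NW]] := chain_family R l a m 0.
rewrite double0 addn0 in Nd; rewrite addn0 in Ns.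
have /fin_all_exists [w wE] i := phi_coordinate i Nd NW.
pose up (i : 'I_l) := if (p <= i)%N then dbl R i + m%:R else 1.
have up_size (i : 'I_l) : (msize (up i) <= (p <= i).+1)%N.
  rewrite /up; case: (p <= i)%N; first by rewrite -mpolyC_nat msize_dbl.
  by rewrite msize1.
exists N, (fun i => (\prod_(j | j != i) edge_factor j) * (up i * w i)); split=> //; split=> //.
- move=> i; have [ws _ _] := wE i.
  have edge_size j : j != i -> (msize (edge_factor j) <= (1 + (p <= j)).+1)%N.
    move=> _; apply: msizeM_leq; last exact: up_size.
    by rewrite -mpolyC_nat -mpolyCN msize_dbl.
  have := msizeM_leq (msize_prod_leq (index_enum _) edge_size) (msizeM_leq (up_size i) ws).
  have : (\sum_(j < l) (1 + (p <= j)) = l + (l - p))%N.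
    by rewrite big_split /= sum_leq_ord // sum_nat_const card_ord muln1.
  rewrite (bigD1 i) //=; move: (\sum_(j | _) _)%N (msize _) => x y.
  by case: (p <= i)%N => /=; lia.
- move=> v i yni; have [_ H _] := wE i.
  have -> : edge_prod = edge_factor i * \prod_(j | j != i) edge_factor j.
    by rewrite /edge_prod (bigD1 i).
  have -> : edge_factor i = (dbl R i - m%:R) * up i by [].
  by rewrite !mevalM H // mevalB meval_dbl meval_nat; ring.
- move=> v i z yz zm; have [_ _ H] := wE i; rewrite !mevalM.
  case: (ltnP i p) zm => ip zm; first by rewrite (H v z) // !mulr0.
  have [zE|zm'] := eqVneq z (- m%:Z); last by rewrite (H v z) ?mulr0 //; lia.
  rewrite /up ip mevalD meval_dbl meval_nat yz zE rmorphN /= -pmulrn addNr.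
  by rewrite mul0r mulr0.
Qed.

Lemma basis_indep N0 f0 (NN : nat -> {poly {mpoly R[l]}}) (ff : nat -> 'I_l -> {mpoly R[l]})
    d0 (d : nat -> nat) (b0 : R) (b : nat -> R) :
  adapted p m a m 0 d0 edge_prod N0 f0 -> (size N0 <= (l * a).+1)%N ->
  (forall k, adapted p m a m.+1 k (d k) 1 (NN k) (ff k) /\
             (size (NN k) <= (l * a + k).+1)%N) ->
  (forall t, b0 * (f0 t).@[generic_point R a (l := l)] +
     \sum_(k < l.-1) b k * (ff k t).@[generic_point R a (l := l)] = 0) ->
  b0 = 0 /\ forall k, (k < l.-1)%N -> b k = 0.
Proof.
set v := generic_point R a (l := l).
move=> [N0W _ f0E _] N0s NNA sum0.
have yni j : nonint (2%:R * v j) := generic_nonint R a j.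
set nu := level R m a; pose P := edge_prod.@[v].
have P0 : P != 0 by apply: edge_prod_neq0.
pose S := \poly_(k < l.-1) b k : {poly R}.
pose Nsum := \sum_(k < l.-1) b k *: (('X - ((nu + 1) ^+ 2)%:P) * evalp v (NN k)).
pose N := (b0 * P) *: evalp v N0 + Nsum.
pose A := evalp v (chain_poly R l a).
pose W := A * ((b0 * P)%:P + ('X - (nu ^+ 2)%:P) * S).
have levelS : level R m.+1 a = nu + 1 by rewrite /nu /level -natr1; ring.
have NW : recurrence nu N W.
  have -> : W = (b0 * P) *: (A * 'X^0) +
      \sum_(k < l.-1) b k *: (('X - (nu ^+ 2)%:P) * (A * 'X^k)).
    rewrite /W mulrDr expr0 mulr1 mulrC mul_polyC; congr (_ + _).
    rewrite /S poly_def mulrA mulr_sumr; apply: eq_bigr => k _.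
    by rewrite -!mul_polyC; ring.
  apply: recurrenceD.
    by apply: recurrenceZ; rewrite /A -evalp_chain_poly; apply: N0W.
  apply: recurrence_sum => k; apply/recurrenceZ/recurrence_shift.
  have [[NkW _ _ _] _] := NNA k.
  by rewrite /A -evalp_chain_poly -levelS; apply: NkW.
have chain j : chain_zero a W (2%:R * v j).
  move=> e ea; rewrite /W hornerM.
  have := @chain_poly_zero _ _ _ v 0 j e ea.
  by rewrite expr0 mulr1 -/A => ->; rewrite mul0r.
have N_size : (size N <= a.+1 * l)%N.
  rewrite (leq_trans (size_polyD _ _)) // geq_max; apply/andP; split.
    rewrite (leq_trans (size_scale_leq _ _)) // (leq_trans (size_poly _ _)) //.
    by rewrite (leq_trans N0s) //; nia.
  rewrite (leq_trans (size_sum _ _ _)) //; apply/bigmax_leqP => k _.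
  rewrite (leq_trans (size_scale_leq _ _)) // mulrC (leq_trans (size_mulXsubC _ _).1) //.
  have [_ Nks] := NNA k; have := ltn_ord k.
  have : (size (evalp v (NN k)) <= (l * a + k).+1)%N.
    by rewrite (leq_trans (size_poly _ _)).
  move: (size _) => x; nia.
have prim0 j : primitive m a N (2%:R * v j + a%:R) = 0.
  rewrite -(sum0 j) f0E // -/v -/P /primitive hornerD hornerZ horner_sum.
  rewrite mulrDl mulr_suml; congr (_ + _).
    by rewrite /primitive; ring.
  apply: eq_bigr => k _; have [[_ _ fkE _] _] := NNA k.
  rewrite fkE // meval1 mul1r -primitive_shift ?hornerZ; first by rewrite /primitive; ring.
  exact: (nonintDz a (yni j)).
have N0' : N = 0.
  apply: (@generic_vanish R l a) => // j e ea.
  have := primitive_chain NW (chain j) (yni j) ea.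
  have -> : primitive m a N (2%:R * v j - a%:R) = 0.
    rewrite -(prim0 j) -(primitive_chain NW (chain j) (yni j) (leqnn a)).
    by congr (primitive _ _ _ _); rewrite -addnn natrD; ring.
  have sni : nonint (2%:R * v j - a%:R + e.*2%:R).
    have := nonintDz (e.*2%:Z - a%:Z) (yni j).
    by rewrite rmorphB /= -!pmulrn addrA addrAC.
  move=> /eqP; rewrite /primitive mulf_eq0 => /orP[/eqP //|].
  by rewrite mulf_eq0 invr_eq0 !(negPf (cprod_neq0 _ sni)).
have W0 : W = 0 by apply: (@recurrence0 _ nu); rewrite -N0'.
have /eqP := W0; rewrite mulf_eq0 (negPf (evalp_chain_neq0 _ _)) /= => /eqP C0.
have b0P : b0 * P = 0.
  have := congr1 (fun q : {poly R} => q.[nu ^+ 2]) C0.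
  by rewrite !hornerE subrr mul0r addr0.
move: C0; rewrite b0P polyC0 add0r => /eqP.
rewrite mulf_eq0 polyXsubC_eq0 /= => /eqP S0; split.
  by move/eqP: b0P; rewrite mulf_eq0 (negPf P0) orbF => /eqP.
move=> k kl; have := congr1 (fun q : {poly R} => q`_k) S0.
by rewrite coef_poly kl coef0.
Qed.

End Basis.

(** * The linear forms of the cone *)

Section Forms.
Variables (R : realType) (l p m a : nat).

(* The index pairs (i, j) with i = j, i < j and j < i stand for the normals of
   2 x_i = s, x_i + x_j = s and x_j - x_i = s. *)
Definition normal_coord (i j t : 'I_l) : R :=
  (t == j)%:R + (-1) ^+ (j < i)%N * (t == i)%:R.

Definition normal (ij : 'I_l * 'I_l) : 'rV[R]_l := \row_t normal_coord ij.1 ij.2 t.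

Definition multiplicity (ij : 'I_l * 'I_l) : nat :=
  if ij.1 == ij.2 then (m.*2 + (p <= ij.1))%N else a.*2.+1.

Definition offset (ij : 'I_l * 'I_l) (k : nat) : int :=
  k%:Z + if ij.1 == ij.2 then (ij.1 < p)%N%:Z - m%:Z else - a%:Z.

Definition indices : seq (option ('I_l * 'I_l * nat)) :=
  None :: map Some
    (allpairs_dep pair (enum {: 'I_l * 'I_l}) (fun ij => iota 0 (multiplicity ij))).

Definition form (t : option ('I_l * 'I_l * nat)) : 'rV[R]_(l + 1) :=
  if t is Some (ij, k) then row_mx (normal ij) (const_mx (- (offset ij k)%:~R))
  else row_mx 0 (const_mx 1).

Lemma mem_indices ij k : (Some (ij, k) \in indices) = (k < multiplicity ij)%N.
Proof.
rewrite inE /= mem_map; last by move=> x y [].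
apply/allpairsPdep/idP => [[x [y [_ + [-> ->]]]]|kij].
  by rewrite mem_iota.
by exists ij, k; rewrite mem_enum mem_iota.
Qed.

Lemma indices_uniq : uniq indices.
Proof.
rewrite /indices cons_uniq map_inj_uniq; last by move=> x y [].
apply/andP; split; first by apply/mapP => -[].
apply: allpairs_uniq_dep; [exact: enum_uniq|by move=> *; apply: iota_uniq|].
by move=> [x1 x2] [y1 y2] _ _ /= [-> ->].
Qed.

Lemma size_indices : (0 < l)%N -> (p <= l)%N ->
  size indices = (l * (l.-1 * a.*2.+1 + m.*2) + (l - p)).+1.
Proof.
move=> l0 pl; rewrite /indices /= size_map size_allpairs_dep sumnE big_map; congr _.+1.
rewrite big_enum /=.
rewrite (eq_bigr multiplicity) => [|ij _]; last by rewrite size_iota.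
rewrite -(pair_bigA _ (fun i j => multiplicity (i, j))) /=.
rewrite (eq_bigr (fun i : 'I_l => l.-1 * a.*2.+1 + m.*2 + (p <= i)))%N => [|i _].
  by rewrite big_split /= sum_leq_ord // sum_nat_const card_ord.
rewrite (bigD1 i) //= /multiplicity /= eqxx.
rewrite (eq_bigr (fun=> a.*2.+1)) => [|j ji]; last by rewrite eq_sym (negPf ji).
rewrite sum_nat_const (_ : #|_| = l.-1); first by lia.
by have := cardC1 i; rewrite card_ord => <-; apply: eq_card => j; rewrite !inE.
Qed.

Lemma normal_coord_neq0 i j t : (normal_coord i j t != 0) = (t == i) || (t == j).
Proof.
rewrite /normal_coord; have [->|tj] := eqVneq t j.
  rewrite orbT; have [->|_] := eqVneq j i; last by rewrite mulr0 addr0 oner_eq0.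
  by rewrite ltnn expr0 mulr1 -mulr2n pnatr_eq0.
by rewrite add0r orbF; have [_|_] := eqVneq t i; rewrite ?mulr0 ?eqxx ?mulr1 ?signr_eq0.
Qed.

Lemma normal_neq0 ij : normal ij != 0.
Proof.
apply/eqP => /rowP/(_ ij.1); rewrite !mxE => /eqP.
by apply/negP; rewrite normal_coord_neq0 eqxx.
Qed.

Lemma normal_scale ij ij' c : normal ij' = c *: normal ij -> ij' = ij /\ c = 1.
Proof.
case: ij ij' => i j [i' j'] /rowP E.
have {}E t : normal_coord i' j' t = c * normal_coord i j t by have := E t; rewrite !mxE.
have c0 : c != 0.
  apply/eqP => c0; have := normal_coord_neq0 i' j' i'.
  by rewrite E c0 mul0r !eqxx.
have sup t : (t == i') || (t == j') = (t == i) || (t == j).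
  by rewrite -!normal_coord_neq0 E mulf_eq0 (negPf c0).
have same : i' = i -> j' = j -> (i', j') = (i, j) /\ c = 1.
  move=> ei ej; rewrite ei ej; split=> //.
  have n0 : normal_coord i j j != 0 by rewrite normal_coord_neq0 eqxx orbT.
  by apply: (mulIf n0); rewrite mul1r -E ei ej.
have /orP[/eqP i'E|/eqP i'E] : (i' == i) || (i' == j) by rewrite -sup eqxx.
  have /orP[/eqP j'E|/eqP j'E] : (j' == i) || (j' == j) by rewrite -sup eqxx orbT.
    have /eqP ji : j == i by have := sup j; rewrite i'E j'E orbb eqxx orbT.
    by apply: same; rewrite // ji.
  exact: same.
have /orP[/eqP j'E|/eqP j'E] : (j' == i) || (j' == j) by rewrite -sup eqxx orbT.
  have [ij|ij] := eqVneq i j; first by apply: same; rewrite ?i'E ?j'E ij.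
  exfalso; have := E i; have := E j; rewrite /normal_coord i'E j'E !eqxx.
  rewrite (negPf ij) eq_sym (negPf ij) /= !mulr0 !addr0 !add0r !mulr1 => <-.
  have := ij; rewrite -val_eqE /= neq_ltn => /orP[] lt.
    by rewrite lt [(j < i)%N]ltnNge (ltnW lt) expr0 mulr1 expr1; lra.
  by rewrite lt [(i < j)%N]ltnNge (ltnW lt) expr0 mul1r expr1; lra.
have /eqP ij : i == j by have := sup i; rewrite i'E j'E orbb eqxx.
by apply: same; rewrite // ij.
Qed.

Lemma form_neq0 t : form t != 0.
Proof.
case: t => [[ij k]|]; last first.
  apply/eqP => /rowP/(_ (rshift l ord0)); rewrite row_mxEr !mxE.
  by move/eqP; rewrite oner_eq0.
apply/eqP => E; case/negP: (normal_neq0 ij); apply/eqP/rowP => t.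
by have /rowP/(_ (lshift 1 t)) := E; rewrite row_mxEl => ->; rewrite !mxE.
Qed.

Lemma form_inj t t' c : form t' = c *: form t -> t = t'.
Proof.
case: t t' => [[ij k]|] [[ij' k']|] //=.
- rewrite scale_row_mx => /eq_row_mx[/normal_scale[-> ->]].
  rewrite scale1r => /matrixP/(_ 0 0); rewrite !mxE => /oppr_inj /intr_inj.
  by rewrite /offset => /addIr [->].
- rewrite scale_row_mx => /eq_row_mx[/esym/eqP + /matrixP/(_ 0 0)].
  rewrite scaler_eq0 (negPf (normal_neq0 _)) orbF => /eqP ->.
  by rewrite scale0r !mxE => /eqP; rewrite oner_eq0.
- rewrite scale_row_mx scaler0 => /eq_row_mx[/eqP + _].
  by rewrite (negPf (normal_neq0 _)).
Qed.

Lemma form_cone t : t \in indices -> cone (@arrC R l p m a) (form t).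
Proof.
case: t => [[[i j] k]|_]; last exact: cone_infinity.
rewrite mem_indices /multiplicity /form /offset /= => kij.
apply: cone_affine; move: kij; have [<-|ij] := eqVneq i j.
  have -> : normal (i, i) = 2%:R *: delta_mx 0 i.
    by apply/rowP => t; rewrite !mxE /normal_coord ltnn expr0 mul1r -mulr2n mulr_natl ?eqxx.
  case: (ltnP i p) => ip kij; [apply: arrC_low|apply: arrC_high]; rewrite // ?ip; lia.
have [ij'|ji] := ltnP i j => kij.
  have -> : normal (i, j) = delta_mx 0 i + delta_mx 0 j.
    apply/rowP => t; rewrite !mxE /normal_coord /= ltnNge (ltnW ij') /= mul1r.
    by rewrite addrC ?eqxx.
  by apply: arrC_add => //; lia.
have {}ji : (j < i)%N by rewrite ltn_neqAle ji andbT eq_sym.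
have -> : normal (i, j) = delta_mx 0 j - delta_mx 0 i.
  by apply/rowP => t; rewrite !mxE /normal_coord /= ji expr1 mulN1r ?eqxx.
by apply: arrC_sub => //; lia.
Qed.

End Forms.

Lemma sum_exponents (l p m a : nat) (c := (2 * m + 2 * a * l - 2 * a)%N) :
  (0 < l)%N -> (p <= l)%N ->
  sumn [:: 1, c + 2 * l - p - 1 & [seq c + (2 * k + 1) | k <- iota 0 (l - 1)]]%N =
  (l * (l.-1 * a.*2.+1 + m.*2) + (l - p)).+1.
Proof.
case: l @c => [//|n] c _ pn.
have sum_map k : sumn [seq c + (2 * k + 1) | k <- iota 0 k]%N = (k * c + k * k)%N.
  elim: k => [|k IH] //; rewrite -[X in iota 0 X]addn1 iotaD map_cat sumn_cat IH /=; lia.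
by rewrite subSS subn0 /= sum_map /c; nia.
Qed.

Local Close Scope ring_scope.

Theorem theorem5p11 (R : realType) (a m l p : nat)
    (l_ge1 : 1 <= l) (p_le_l : p <= l) :
  let c := 2 * m + 2 * a * l - 2 * a in
  let A : central_arrangement R (l + 1) := cone (@arrC R l p m a) in
  free_arrangement A /\
  has_exponents A
    [:: 1, c + 2 * l - p - 1 & [seq c + (2 * k + 1) | k <- iota 0 (l - 1)]].
Proof.
move=> c A; set e := [:: _, _ & _].
suff expA : has_exponents A e by split=> //; apply: has_exponents_free expA.
have [N0 [f0 [f0A N0s]]] := @phi_family R l p m a l_ge1 p_le_l.
have [NN] := boolp.choice (@theta_family R l p m a l_ge1).
move=> /boolp.choice [ff ffA].
pose d k := if k is k'.+1 then (c + (2 * k' + 1))%N else (c + 2 * l - p - 1)%N.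
pose F k := if k is k'.+1 then ff k' else f0.
have nth_e k : (k < l)%N -> nth 0%N e k.+1 = d k.
  case: k => [|k] kl //=; rewrite (nth_map 0%N) ?size_iota ?nth_iota //; lia.
have F_size k i : (msize (F k i) <= (d k).+1)%N.
  by case: k => [|k]; [case: f0A => _ H _ _|case: (ffA k) => -[_ H _ _] _]; apply: H.
apply: (saito_criterion (s := indices l p m a) (F := @form R l p m a) (M := cone_matrix d F)).
- exact: indices_uniq.
- by move=> t _; apply: form_neq0.
- by move=> t t' _ _ c'; apply: form_inj.
- by move=> t; apply: form_cone.
- move=> al Aal i; apply: cone_matrix_row => k kl.
  case: k kl => [|k] kl; first exact: (adapted_row_log f0A).
  exact: (adapted_row_log (ffA k).1).
- move=> i j; rewrite mxE; case Ei : (nat_of_ord i) => [|k].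
    by rewrite dhomogX /= mdeg1.
  rewrite nth_e; last by have := ltn_ord i; rewrite Ei addn1.
  by rewrite mxE; case: (split j) => t; [apply: homogenize_homog|apply: dhomog0].
- by rewrite /= size_map size_iota; lia.
- by rewrite size_indices // sum_exponents.
apply: (@cone_matrix_det R l d F (generic_point R a (l := l))) => b sum0.
set v := generic_point R a (l := l) in sum0.
have sum0' t :
  (b 0%N * (f0 t).@[v] + \sum_(k < l.-1) b k.+1 * (ff k t).@[v] = 0)%R.
  have recl (G : nat -> R) :
      (\sum_(k < l) G k = G 0%N + \sum_(k < l.-1) G k.+1)%R.
    by rewrite -(big_mkord xpredT) -(prednK l_ge1) big_nat_recl // big_mkord.
  by rewrite -[RHS](sum0 t) (recl (fun k => b k * (F k t).@[v])%R).
have [b0 bk] := basis_indep (b := fun k => b k.+1) l_ge1 p_le_l f0A N0s ffA sum0'.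
by case=> [|k] kl //; apply: bk; lia.
Qed.
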